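(* For an arbitrary Frobenius manifold, which is locally given by a solution $\Phi(u^1,\dots,u^N)$ of the associativity equations $$\sum_{k,l=1}^N\frac{\partial^3\Phi}{\partial u^i\partial u^j\partial u^k}\eta^{kl}\frac{\partial^3\Phi}{\partial u^l\partial u^m\partial u^n}=\sum_{k,l=1}^N\frac{\partial^3\Phi}{\partial u^i\partial u^m\partial u^k}\eta^{kl}\frac{\partial^3\Phi}{\partial u^l\partial u^j\partial u^n},\qquad 1\le i,j,m,n\le N,$$ the corresponding potential flat torsionless submanifold in a $2N$-dimensional pseudo-Euclidean space that realizes this Frobenius manifold is given by the $2N$-component vector function $r(u^1,\dots,u^N)$ satisfying the following compatible linear system of second-order partial differential equations: $$\frac{\partial^2r}{\partial u^i\partial u^j}=c\,\eta^{kl}\frac{\partial^3\Phi}{\partial u^i\partial u^j\partial u^k}\frac{\partial n}{\partial u^l},\qquad \frac{\partial^2n}{\partial u^i\partial u^j}=-\eta^{kl}\frac{\partial^3\Phi}{\partial u^i\partial u^j\partial u^k}\frac{\partial r}{\partial u^l},$$ where $n(u^1,\dots,u^N)$ is a $2N$-component vector function and $c$ is an arbitrary nonzero constant (a deformation parameter preserving the corresponding Frobenius structure). In particular, the two essentially different cases $c=1$ and $c=-1$ correspond to ambient $2N$-dimensional pseudo-Euclidean spaces of different signatures (if the metric $\eta_{ij}$ has a nonzero signature). The consistency of this linear system is equivalent to the associativity equations.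
   Context: All objects are smooth and local; repeated upper and lower indices are summed. Here $u^i$ are flat coordinates of the flat metric of the Frobenius manifold, $\eta_{ij}$ is its constant matrix, $\eta^{ij}$ the inverse; the Frobenius manifold is locally given by $\Phi$ in the sense that its multiplication is $\partial_i\circ\partial_j=\eta^{ks}\frac{\partial^3\Phi}{\partial u^s\partial u^i\partial u^j}\partial_k$. (A Frobenius manifold in Dubrovin's sense is a manifold with a flat metric $g$ and a smoothly varying commutative associative multiplication on tangent spaces with $g(X\circ Y,Z)=g(X,Y\circ Z)$, with $\nabla_W\big(g(X\circ Y,Z)\big)$-tensor totally symmetric in $X,Y,Z,W$, with covariantly constant unit field $U$, and with an Euler field $E$: $\nabla\nabla E=0$, $\mathcal L_E(X\circ Y)-(\mathcal L_EX)\circ Y-X\circ\mathcal L_EY=X\circ Y$, $\mathcal L_E\,g(X,Y)-g(\mathcal L_EX,Y)-g(X,\mathcal L_EY)=K\,g(X,Y)$ with $K$ constant, $\mathcal L_EU=-U$.) A pseudo-Euclidean space is a real vector space with a constant nondegenerate symmetric bilinear form $(\cdot,\cdot)$; submanifolds $r(u)$ have nondegenerate first fundamental form $g_{ij}=(r_{u^i},r_{u^j})$. The submanifold is flat if $g_{ij}$ is flat, torsionless if there is a normal basis $n_\alpha$ with constant Gram matrix and $(n_{\alpha,u^i},n_\beta)=0$, and (with second fundamental forms $(\omega_\alpha)_{ij}=(n_\alpha,r_{u^iu^j})$) potential if codimension equals dimension $N$ and locally $(\omega_i)_{jk}=\nabla_i\nabla_j\nabla_k\Phi$ for a function $\Phi$,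 $\nabla$ being the Levi-Civita connection of $g_{ij}$. The potential submanifold realizing the Frobenius manifold given by $\Phi$ is the one (unique up to motions) with first fundamental form $\eta_{ij}\,du^i\,du^j$, second fundamental forms $(\omega_n)_{ij}=\partial^3\Phi/\partial u^n\partial u^i\partial u^j$ and normal Gram matrix $(n_i,n_j)=\mu_{ij}$ whose inverse is $\mu^{ij}=c\,\eta^{ij}$; in the linear system the normals are $n_l=\partial n/\partial u^l$. Signature of the ambient space is the sum of the signatures of $\eta_{ij}$ and $\mu_{ij}$. *)

(* Defs.v *)
From HB Require Import structures.
From mathcomp Require Import all_boot all_order all_algebra.
From mathcomp Require Import all_classical all_reals all_analysis.

Set Implicit Arguments.
Unset Strict Implicit.
Unset Printing Implicit Defensive.

Import Order.TTheory GRing.Theory Num.Theory.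
Import numFieldNormedType.Exports.

Local Open Scope classical_set_scope.
Local Open Scope ring_scope.

Section Smooth.
Variables (R : realType) (N : nat) (V : normedModType R).

Definition pd (i : 'I_N) (f : 'rV[R]_N -> V) : 'rV[R]_N -> V :=
  fun u => 'D_(delta_mx 0 i) f u.

(* C^oo on D (meant for D open): every iterated partial derivative, including
   f itself for s = [::], is Frechet differentiable, hence also continuous,
   at every point of D. *)
Definition smooth (D : set 'rV[R]_N) (f : 'rV[R]_N -> V) : Prop :=
  forall (s : seq 'I_N) u, D u -> differentiable (foldr pd f s) u.

End Smooth.

Section Forms.
Variable R : realType.

Definition dot (M : nat) (G : 'M[R]_M) (x y : 'rV[R]_M) : R :=
  (x *m G *m y^T) 0 0.

Definition nondeg_sym (M : nat) (G : 'M[R]_M) : Prop :=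
  G^T = G /\ G \in unitmx.

(* Largest dimension of a subspace (the span of the rows of B) on which the
   symmetric form G is positive definite. *)
Definition pos_index (M : nat) (G : 'M[R]_M) : nat :=
  \max_(k < M.+1 | `[< exists B : 'M[R]_(k, M),
      forall x : 'rV[R]_k, x != 0 -> 0 < dot G (x *m B) (x *m B) >]) k.

Definition signature (M : nat) (G : 'M[R]_M) : int :=
  (pos_index G)%:Z - (pos_index (- G))%:Z.

End Forms.

Section Metric.
Variables (R : realType) (N : nat).
Implicit Types (g : 'rV[R]_N -> 'M[R]_N) (u : 'rV[R]_N) (D : set 'rV[R]_N).
Implicit Types (i j k l m : 'I_N) (f : 'rV[R]_N -> R).

(* Gamma^k_(ij) of the Levi-Civita connection of g *)
Definition christoffel g k i j u : R :=
  2^-1 * (\sum_l invmx (g u) k l *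
    (pd i (fun v => g v l j) u + pd j (fun v => g v l i) u
     - pd l (fun v => g v i j) u)).

(* R^l_(k i j), with R(X, Y) = [nabla_X, nabla_Y] - nabla_[X, Y] *)
Definition riemann g l k i j u : R :=
  pd i (christoffel g l j k) u - pd j (christoffel g l i k) u
  + \sum_m (christoffel g l i m u * christoffel g m j k u
            - christoffel g l j m u * christoffel g m i k u).

Definition flat_metric D g : Prop :=
  forall u, D u -> forall l k i j, riemann g l k i j u = 0.

(* nabla_j nabla_k f and nabla_i nabla_j nabla_k f *)
Definition nabla2 g f j k u : R :=
  pd j (pd k f) u - \sum_l christoffel g l j k u * pd l f u.

Definition nabla3 g f i j k u : R :=
  pd i (nabla2 g f j k) u
  - \sum_l christoffel g l i j u * nabla2 g f l k u
  - \sum_l christoffel g l i k u * nabla2 g f j l u.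

End Metric.

(* Submanifolds r of dimension N and codimension K in the pseudo-Euclidean
   space R^(N + K) with Gram matrix G; D is the coordinate domain. *)
Section Submanifolds.
Variables (R : realType) (N K : nat).
Implicit Types (D : set 'rV[R]_N) (G : 'M[R]_(N + K)) (u : 'rV[R]_N).
Implicit Types (r : 'rV[R]_N -> 'rV[R]_(N + K)).
Implicit Types (nu : 'I_K -> 'rV[R]_N -> 'rV[R]_(N + K)).

Definition first_form G r u : 'M[R]_N :=
  \matrix_(i, j) dot G (pd i r u) (pd j r u).

Definition second_form G r nu (a : 'I_K) u : 'M[R]_N :=
  \matrix_(i, j) dot G (nu a u) (pd i (pd j r) u).

Definition normal_gram G nu u : 'M[R]_K :=
  \matrix_(a, b) dot G (nu a u) (nu b u).

Definition submanifold D G r : Prop :=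
  [/\ open D, nondeg_sym G, smooth D r
    & forall u, D u -> first_form G r u \in unitmx].

(* As the first fundamental form is nondegenerate, the normal space has
   dimension K, so K linearly independent normals form a basis of it. *)
Definition normal_frame D G r nu : Prop :=
  [/\ forall a, smooth D (nu a),
      forall u, D u -> forall a i, dot G (nu a u) (pd i r u) = 0
    & forall u, D u -> row_free (\matrix_a nu a u)].

Definition torsionless_frame D G r nu : Prop :=
  [/\ normal_frame D G r nu,
      exists mu : 'M[R]_K, forall u, D u -> normal_gram G nu u = mu
    & forall u, D u -> forall i a b, dot G (pd i (nu a) u) (nu b u) = 0].

End Submanifolds.

Section Potential.
Variables (R : realType) (N : nat).
Implicit Types (D : set 'rV[R]_N) (G : 'M[R]_(N + N)) (eta : 'M[R]_N).
Implicit Types (r n : 'rV[R]_N -> 'rV[R]_(N + N)) (Phi : 'rV[R]_N -> R).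
Implicit Types (nu : 'I_N -> 'rV[R]_N -> 'rV[R]_(N + N)) (c : R).

Definition potential_frame D G r nu : Prop :=
  forall u0, D u0 -> exists (W : set 'rV[R]_N) (Psi : 'rV[R]_N -> R),
    [/\ open W, W u0, W `<=` D, smooth W Psi
      & forall u, W u -> forall i j k,
          second_form G r nu i u j k = nabla3 (first_form G r) Psi i j k u].

Definition potential_flat_torsionless D G r : Prop :=
  [/\ submanifold D G r, flat_metric D (first_form G r)
    & exists nu, torsionless_frame D G r nu /\ potential_frame D G r nu].

Definition D3 Phi (i j k : 'I_N) (u : 'rV[R]_N) : R := pd i (pd j (pd k Phi)) u.

Definition associativity D eta Phi : Prop :=
  forall u, D u -> forall i j m n : 'I_N,
    \sum_k \sum_l D3 Phi i j k u * invmx eta k l * D3 Phi l m n u =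
    \sum_k \sum_l D3 Phi i m k u * invmx eta k l * D3 Phi l j n u.

(* r, with the torsionless normal frame nu, is a potential submanifold
   realizing Phi with deformation parameter c. *)
Definition realizes D G eta Phi c r nu : Prop :=
  [/\ potential_flat_torsionless D G r, torsionless_frame D G r nu
    & forall u, D u ->
      [/\ first_form G r u = eta,
          invmx (normal_gram G nu u) = c *: invmx eta
        & forall m i j, second_form G r nu m u i j = D3 Phi m i j u]].

(* The multiplication on tangent spaces defined by a submanifold: its structure
   functions are the second fundamental forms with the index of the normal
   raised by the first fundamental form (not by the normal Gram matrix). *)
Definition induced_mul G r nu (u X Y : 'rV[R]_N) : 'rV[R]_N :=
  \row_k \sum_i \sum_j \sum_s invmx (first_form G r u) k s
    * second_form G r nu s u i j * X 0 i * Y 0 j.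

Definition solves D eta Phi c r n : Prop :=
  [/\ smooth D r, smooth D n
    & forall u, D u -> forall i j,
      pd i (pd j r) u =
        \sum_k \sum_l (c * invmx eta k l * D3 Phi i j k u) *: pd l n u
      /\
      pd i (pd j n) u =
        - (\sum_k \sum_l (invmx eta k l * D3 Phi i j k u) *: pd l r u)].

(* Consistency of the overdetermined system, i.e. complete integrability: since
   all second derivatives are prescribed, a solution near u0 is determined by
   its 1-jet at u0; consistency means that every 1-jet is attained. *)
Definition consistent D eta Phi c : Prop :=
  forall u0, D u0 ->
  forall (r0 n0 : 'rV[R]_(N + N)) (r1 n1 : 'I_N -> 'rV[R]_(N + N)),
  exists (W : set 'rV[R]_N) r n,
    [/\ open W, W u0, W `<=` D, solves W eta Phi c r n
      & [/\ r u0 = r0, n u0 = n0, forall i, pd i r u0 = r1 i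
          & forall i, pd i n u0 = n1 i]].

End Potential.

(* Frobenius manifolds in flat coordinates on D: the metric is the constant
   matrix eta, so the Levi-Civita connection is the directional derivative 'D,
   tangent vectors are row vectors, and a vector field is a function
   'rV_N -> 'rV_N. *)
Section Frobenius.
Variables (R : realType) (N : nat).
Local Notation vec := 'rV[R]_N.
Implicit Types (D : set vec) (eta : 'M[R]_N) (X Y Z W : vec).
Implicit Types (mul : vec -> vec -> vec -> vec) (e E : vec -> vec).

Definition lie (A B : vec -> vec) (u : vec) : vec :=
  'D_(A u) B u - 'D_(B u) A u.

Definition mul_field mul (A B : vec -> vec) (u : vec) : vec :=
  mul u (A u) (B u).

(* (nabla_W (g(X o Y, Z)))(X, Y, Z) for constant W, X, Y, Z *)
Definition nabla_mul eta mul W X Y Z (u : vec) : R :=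
  'D_W (fun v => dot eta (mul v X Y) Z) u.

Record frobenius_multiplication D eta mul : Prop := FrobeniusMultiplication {
  fm_linear : forall u, D u -> forall a X Y Z,
    mul u (a *: X + Y) Z = a *: mul u X Z + mul u Y Z;
  fm_comm : forall u, D u -> forall X Y, mul u X Y = mul u Y X;
  fm_assoc : forall u, D u -> forall X Y Z,
    mul u (mul u X Y) Z = mul u X (mul u Y Z);
  fm_smooth : forall X Y, smooth D (fun u => mul u X Y);
  fm_invariant : forall u, D u -> forall X Y Z,
    dot eta (mul u X Y) Z = dot eta X (mul u Y Z);
  fm_nabla_sym : forall u, D u -> forall W X Y Z,
    [/\ nabla_mul eta mul W X Y Z u = nabla_mul eta mul X W Y Z u,
        nabla_mul eta mul W X Y Z u = nabla_mul eta mul W Y X Z u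
      & nabla_mul eta mul W X Y Z u = nabla_mul eta mul W X Z Y u] }.

Definition flat_unit_field D mul e : Prop :=
  [/\ smooth D e, forall u, D u -> forall X, mul u (e u) X = X
    & forall u, D u -> forall X, 'D_X e u = 0].

Record euler_field D eta mul e E : Prop := EulerField {
  ef_smooth : smooth D E;
  ef_affine : forall u, D u -> forall X Y, 'D_X ('D_Y E) u = 0;
  ef_mul : forall A B : vec -> vec, smooth D A -> smooth D B ->
    forall u, D u ->
      lie E (mul_field mul A B) u - mul_field mul (lie E A) B u
      - mul_field mul A (lie E B) u = mul_field mul A B u;
  ef_metric : exists K : R, forall A B : vec -> vec,
    smooth D A -> smooth D B -> forall u, D u ->
      'D_(E u) (fun v => dot eta (A v) (B v)) u
      - dot eta (lie E A u) (B u) - dot eta (A u) (lie E B u)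
      = K * dot eta (A u) (B u);
  ef_unit : forall u, D u -> lie E e u = - e u }.

Definition frobenius_manifold D eta mul e E : Prop :=
  [/\ open D, nondeg_sym eta, frobenius_multiplication D eta mul,
      flat_unit_field D mul e & euler_field D eta mul e E].

Definition given_by D eta mul (Phi : vec -> R) : Prop :=
  forall u, D u -> forall i j : 'I_N,
    mul u (delta_mx 0 i) (delta_mx 0 j) =
    \sum_k \sum_s (invmx eta k s * D3 Phi s i j u) *: delta_mx 0 k.

End Frobenius.

(* Main.v *)
Require Import Defs.
From HB Require Import structures.
From mathcomp Require Import all_boot all_order all_algebra.
From mathcomp Require Import all_classical all_reals all_analysis.
From mathcomp Require Import ring lra zify.

Set Implicit Arguments.
Unset Strict Implicit.
Unset Printing Implicit Defensive.

Import Order.TTheory GRing.Theory Num.Theory.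
Import numFieldNormedType.Exports.

Local Open Scope classical_set_scope.
Local Open Scope ring_scope.

(* Taking r, n and their first derivatives as one unknown y turns the system
   into d_i y = A_i y, and the curvature of the connection A is, up to the
   factor c, the associator of the multiplication. Every 1-jet is attained iff
   this connection is flat, that is, iff the associativity equations hold.

   Solvability of a flat system with smooth coefficients is obtained from Euler
   polygons y_n drawn with step 1/n along the rays issuing from u0: flatness
   cancels the terms of first order, so d_i y_n - A_i y_n = O(1/n). On a small
   ball two such approximate solutions with the same initial value are close,
   hence the y_n converge uniformly together with their gradients.

   The scalar products of the vectors d_i r, d_i n satisfy a linear system of
   their own, which has the constants eta, 0, c^-1 eta as a solution; by
   uniqueness they keep these values once they have them at one point.
   Conversely, in the frame of tangent vectors and normals, the Gauss and
   Weingarten equations of a realizing submanifold are the given system, so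
   that frames agree up to the linear isometry relating them at one point. The
   Gram matrix of the frame is the orthogonal sum of eta and c^-1 eta, which
   gives the signature by Sylvester's law of inertia. *)

(** For a fixed step an Euler polygon is a finite polynomial expression in the coordinates and in
    the coefficients at points of the ray, so it is differentiated in [u] by the sum and product
    rules; no differentiable dependence of a flow on parameters enters. The quantity to control is
    the defect [d_i y - p A_i y] at the node of parameter [p], where the factor [p] appears because
    the node [c + p (u - c)] moves with [u] at rate [p]. One step multiplies the defect by at most
    [1 + h / 2] and adds [O(h^2)], which leaves [O(h)] after [1 / h] steps.

    The one half comes from the radius: [rho] times the bound [M] of the coefficients and their
    derivatives, times the number of pairs of indices, is at most [1 / 2]. The same inequality is
    the contraction factor behind uniqueness and convergence.

    The limit only yields first derivatives. Smoothness follows from the system itself, because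
    partial derivatives of a solution are polynomials in the solution and in smooth functions.

    The potential [n] of given normals is not integrated from them: the system is solved with their
    values at one point, and uniqueness of frames identifies the result. *)

Section PartialDerivatives.
Variables (R : realType) (N : nat).
Local Notation vec := 'rV[R]_N.

(** * Partial derivatives of vector-valued functions, and smoothness as a local property *)

Section Values.
Variable V : normedModType R.
Implicit Types (f g : vec -> V) (D : set vec) (s : seq 'I_N).

Lemma near_open_eq D f g u : open D -> D u -> (forall v, D v -> f v = g v) ->
  \near u, f u = g u.
Proof.
move=> oD Du fg; near=> v; apply: fg; near: v; exact: open_nbhs_nbhs.
Unshelve. all: by end_near. Qed.

(** Trades the little-o of the definition for an explicit inequality, which is what the uniform
    limit argument produces. *)
Lemma differentiable_of_linear_approx f u (L : {linear vec -> V}) :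
  continuous L ->
  (forall e, 0 < e -> \forall h \near (0 : vec),
     `|f (h + u) - f u - L h| <= e * `|h|) ->
  differentiable f u /\ 'd f u = L :> (vec -> V).
Proof.
move=> cL fL; have fo : f \o shift u = cst (f u) + L +o_ (0 : vec) id.
  apply/eqaddoP => e e0; apply: filterS (fL e e0) => h /=.
  by rewrite !fctE /= opprD addrA.
have E : 'd f u = L :> (vec -> V) by exact: diff_unique.
by split=> //; apply/diff_locallyP; rewrite E.
Qed.

Lemma linear_approx_of_differentiable f u e : differentiable f u -> 0 < e ->
  \forall h \near (0 : vec), `|f (h + u) - f u - 'd f u h| <= e * `|h|.
Proof.
move=> /diff_locally/eqaddoP df e0; apply: filterS (df e e0) => h /=.
by rewrite !fctE /= opprD addrA.
Qed.

Lemma near_eq_differentiable f g u : (\near u, f u = g u) ->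
  differentiable f u -> differentiable g u.
Proof.
move=> fg df; have fgu : f u = g u by exact: nbhs_singleton fg.
have fs : \forall h \near (0 : vec), f (h + u) = g (h + u).
  move: fg; rewrite (near_shift 0) => fs; near=> h.
  have : (f \o shift (u - 0)) h = (g \o shift (u - 0)) h by near: h; exact: fs.
  by rewrite /= subr0.
have approx e : 0 < e -> \forall h \near (0 : vec),
    `|g (h + u) - g u - 'd f u h| <= e * `|h|.
  move=> e0; have := linear_approx_of_differentiable df e0.
  by apply: filterS2 fs => h ->; rewrite fgu.
by have [] := differentiable_of_linear_approx (diff_continuous df) approx.
Unshelve. all: by end_near. Qed.

Lemma pd_eq D f g i : open D -> (forall v, D v -> f v = g v) ->
  forall u, D u -> pd i f u = pd i g u.
Proof. by move=> oD fg u Du; apply/near_eq_derive/(near_open_eq oD Du). Qed.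

Lemma foldr_pd_eq D f g s : open D -> (forall v, D v -> f v = g v) ->
  forall u, D u -> foldr (@pd R N V) f s u = foldr (@pd R N V) g s u.
Proof.
move=> oD fg; elim: s => //= i s IH u Du.
exact: (pd_eq i oD IH).
Qed.

Lemma smooth_sub D D' f : D' `<=` D -> smooth D f -> smooth D' f.
Proof. by move=> DD sf s u /DD; exact: sf. Qed.

Lemma smooth_differentiable D f u : smooth D f -> D u -> differentiable f u.
Proof. by move=> /(_ [::]); apply. Qed.

Lemma smooth_pd D f i : smooth D f -> smooth D (pd i f).
Proof.
(* The last index of the word is the innermost derivative. *)
move=> sf s u Du; have := sf (rcons s i) u Du.
by rewrite -cats1 foldr_cat.
Qed.

Lemma pd_cst (a : V) (i : 'I_N) (u : vec) : pd i (fun=> a) u = 0.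
Proof. exact: derive_cst. Qed.

Lemma smooth_cst D (a : V) : smooth D (fun=> a).
Proof.
have H s : exists b, foldr (@pd R N V) (fun=> a) s = (fun=> b).
  elim: s => [|i s [b IH]]; first by exists a.
  by exists 0; rewrite /= IH; apply/funext => u; exact: pd_cst.
by move=> s u _; have [b ->] := H s; exact: differentiable_cst.
Qed.

Lemma pdD f g i u : differentiable f u -> differentiable g u ->
  pd i (fun v => f v + g v) u = pd i f u + pd i g u.
Proof. by move=> df dg; apply: deriveD; exact: diff_derivable. Qed.

Lemma pdB f g i u : differentiable f u -> differentiable g u ->
  pd i (fun v => f v - g v) u = pd i f u - pd i g u.
Proof. by move=> df dg; apply: deriveB; exact: diff_derivable. Qed.

Lemma pdZ (a : R) f i u : differentiable f u ->
  pd i (fun v => a *: f v) u = a *: pd i f u.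
Proof. by move=> df; apply: deriveZ; exact: diff_derivable. Qed.

Lemma derive_pd f u (x : vec) : differentiable f u ->
  'D_x f u = \sum_i x 0 i *: pd i f u.
Proof.
move=> df; rewrite deriveE // {1}[x]row_sum_delta raddf_sum /=.
by apply: eq_bigr => i _; rewrite linearZ /pd deriveE.
Qed.

Lemma differentiable_fsum (I : Type) (r : seq I) (F : I -> vec -> V) u :
  (forall j, differentiable (F j) u) ->
  differentiable (fun v => \sum_(j <- r) F j v) u.
Proof.
move=> dF; elim: r => [|j r IH].
  have -> : (fun v => \sum_(j <- [::]) F j v) = (fun=> 0).
    by apply/funext => v; rewrite big_nil.
  exact: differentiable_cst.
have -> : (fun v => \sum_(j <- j :: r) F j v) =
    (fun v => F j v + \sum_(j <- r) F j v).
  by apply/funext => v; rewrite big_cons.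
exact: differentiableD.
Qed.

Lemma pd_sum (I : Type) (r : seq I) (F : I -> vec -> V) i u :
  (forall j, differentiable (F j) u) ->
  pd i (fun v => \sum_(j <- r) F j v) u = \sum_(j <- r) pd i (F j) u.
Proof.
move=> dF; elim: r => [|j r IH].
  have -> : (fun v => \sum_(j <- [::]) F j v) = (fun=> 0).
    by apply/funext => v; rewrite big_nil.
  by rewrite big_nil pd_cst.
have -> : (fun v => \sum_(j <- j :: r) F j v) =
    (fun v => F j v + \sum_(j <- r) F j v).
  by apply/funext => v; rewrite big_cons.
by rewrite big_cons pdD ?IH //; exact: differentiable_fsum.
Qed.

End Values.

(** * Smoothness of polynomial expressions in scalar functions *)

Section Scalars.
Implicit Types (f g : vec -> R) (D : set vec).

Lemma pdM f g i u : differentiable f u -> differentiable g u ->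
  pd i (fun v => f v * g v) u = f u * pd i g u + pd i f u * g u.
Proof.
move=> df dg; rewrite /pd deriveM; [|exact: diff_derivable..].
by congr (_ + _); exact: mulrC.
Qed.

(** Sums and products only: constants are available when [B] contains them. *)
Inductive poly_span (B : set (vec -> R)) : (vec -> R) -> Prop :=
| poly_span_base f : B f -> poly_span B f
| poly_spanD f g : poly_span B f -> poly_span B g ->
    poly_span B (fun u => f u + g u)
| poly_spanM f g : poly_span B f -> poly_span B g ->
    poly_span B (fun u => f u * g u).

(* A coinduction principle for smoothness: it suffices that the partial
   derivatives of the functions of B are polynomials in functions of B. *)
Lemma smooth_poly_span D B : open D ->
  (forall f, B f -> (forall u, D u -> differentiable f u) /\
     forall i, exists2 g, poly_span B g & forall u, D u -> pd i f u = g u) ->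
  forall f, poly_span B f -> smooth D f.
Proof.
move=> oD BP; have SP f : poly_span B f ->
    (forall u, D u -> differentiable f u) /\
    forall i, exists2 g, poly_span B g & forall u, D u -> pd i f u = g u.
  elim=> [{}f /BP //|{}f g sf [df pf] sg [dg pg]|{}f g sf [df pf] sg [dg pg]].
  - split=> [u Du|i]; first by apply: differentiableD; [exact: df|exact: dg].
    have [f' sf' ff'] := pf i; have [g' sg' gg'] := pg i.
    exists (fun u => f' u + g' u); first exact: poly_spanD.
    by move=> u Du; rewrite pdD ?ff' ?gg' //; [exact: df|exact: dg].
  - split=> [u Du|i]; first by apply: differentiableM; [exact: df|exact: dg].
    have [f' sf' ff'] := pf i; have [g' sg' gg'] := pg i.
    exists (fun u => f u * g' u + f' u * g u).
      by apply: poly_spanD; exact: poly_spanM.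
    by move=> u Du; rewrite pdM ?ff' ?gg' //; [exact: df|exact: dg].
(* The innermost derivative is peeled off: [pd i f] agrees on [D] with some [g] of the span, and the
   induction hypothesis holds for every function of the span. *)
move=> f sf s; elim/last_ind: s f sf => [|s i IH] f sf u Du.
  by have [df _] := SP f sf; exact: df.
have [_ /(_ i)[g sg fg]] := SP f sf.
rewrite -cats1 foldr_cat /=; apply: near_eq_differentiable (IH g sg u Du).
apply: (near_open_eq oD Du) => v Dv.
by apply/esym/(foldr_pd_eq s oD fg).
Qed.

Lemma smooth_closed D f : open D -> poly_span (smooth D) f -> smooth D f.
Proof.
move=> oD; apply: smooth_poly_span => // g sg; split=> [u Du|i].
  exact: smooth_differentiable sg Du.
by exists (pd i g) => //; exact/poly_span_base/smooth_pd.
Qed.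

Lemma smoothM D f g : open D -> smooth D f -> smooth D g ->
  smooth D (fun u => f u * g u).
Proof.
by move=> oD sf sg; apply: smooth_closed => //; apply: poly_spanM;
  exact: poly_span_base.
Qed.

Lemma poly_span_sum B (I : finType) (F : I -> vec -> R) :
  B (fun=> 0) -> (forall j, poly_span B (F j)) ->
  poly_span B (fun u => \sum_j F j u).
Proof.
move=> B0 BF; elim: (index_enum I) => [|j r IH].
  have -> : (fun u => \sum_(j <- [::]) F j u) = (fun=> 0).
    by apply/funext => u; rewrite big_nil.
  exact: poly_span_base.
have -> : (fun u => \sum_(j <- j :: r) F j u) =
    (fun u => F j u + \sum_(j <- r) F j u).
  by apply/funext => u; rewrite big_cons.
exact: poly_spanD.
Qed.

Lemma smooth_sum D (I : finType) (F : I -> vec -> R) : open D ->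
  (forall j, smooth D (F j)) -> smooth D (fun u => \sum_j F j u).
Proof.
move=> oD sF; apply: smooth_closed => //; apply: poly_span_sum => [|j].
  exact: smooth_cst.
exact: poly_span_base.
Qed.

Lemma pd_sumM (I : finType) (F G : I -> vec -> R) i u :
  (forall j, differentiable (F j) u) -> (forall j, differentiable (G j) u) ->
  pd i (fun v => \sum_j F j v * G j v) u =
  \sum_j (F j u * pd i (G j) u + pd i (F j) u * G j u).
Proof.
move=> dF dG; rewrite pd_sum => [|j]; last exact: differentiableM.
by apply: eq_bigr => j _; rewrite pdM.
Qed.

End Scalars.

(** * Differentiability and smoothness componentwise *)

Section Components.
Variable M : nat.
Implicit Types (r : vec -> 'rV[R]_M) (D : set vec).

Lemma differentiable_rowP r u :
  differentiable r u <-> forall k, differentiable (fun v => r v 0 k) u.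
Proof.
split=> [dr k|dr].
  exact: (differentiable_comp dr (differentiable_coord _ _ _)).
have -> : r = \sum_k (fun v => r v 0 k *: delta_mx 0 k).
  apply/funext => v; rewrite fct_sumE; exact: row_sum_delta.
by apply: differentiable_sum => k; exact: differentiableZl.
Qed.

Lemma pd_row r u i k : differentiable r u ->
  pd i (fun v => r v 0 k) u = pd i r u 0 k.
Proof.
by move=> dr; rewrite /pd (derive_mx (diff_derivable (v := _) dr)) mxE.
Qed.

Lemma foldr_pd_row D r s k u : open D -> smooth D r -> D u ->
  foldr (@pd R N R) (fun v => r v 0 k) s u = foldr (@pd R N _) r s u 0 k.
Proof.
move=> oD sr; elim: s u => //= i s IH u Du.
by rewrite (pd_eq i oD IH Du) pd_row //; exact: sr.
Qed.

(** Here only the components are known to be smooth, so differentiability of the vector-valued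
    derivative has to be rebuilt from them at each order before [pd_row] applies. *)
Lemma foldr_pd_row' D r s k u : open D ->
  (forall k, smooth D (fun v => r v 0 k)) -> D u ->
  foldr (@pd R N _) r s u 0 k = foldr (@pd R N R) (fun v => r v 0 k) s u.
Proof.
move=> oD sr; elim: s u k => //= i s IH u k Du.
rewrite -pd_row; first exact: (pd_eq i oD (fun v Dv => IH v k Dv)).
apply/differentiable_rowP => l.
apply: near_eq_differentiable (sr l s u Du).
by apply: (near_open_eq oD Du) => v Dv; rewrite IH.
Qed.

Lemma smooth_rowP D r : open D ->
  smooth D r <-> forall k, smooth D (fun v => r v 0 k).
Proof.
move=> oD; split=> [sr k s u Du|sr s u Du].
  apply: (@near_eq_differentiable _ (fun v => foldr (@pd R N _) r s v 0 k)).
    apply: (near_open_eq oD Du) => v Dv; exact/esym/(foldr_pd_row s k oD).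
  by have /differentiable_rowP := sr s u Du.
apply/differentiable_rowP => k; apply: near_eq_differentiable (sr k s u Du).
by apply: (near_open_eq oD Du) => v Dv; rewrite (foldr_pd_row' s k oD sr Dv).
Qed.

End Components.
End PartialDerivatives.

(** * Mean value theorem on balls and equality of mixed derivatives *)

Section MeanValue.
Variables (R : realType) (N : nat).
Local Notation vec := 'rV[R]_N.
Implicit Types (f : vec -> R) (D : set vec) (u c h : vec).

Lemma ler_norm_coord (x : vec) i : `|x 0 i| <= `|x|.
Proof.
rewrite [leRHS]/Num.Def.normr/= mx_normrE.
exact: (@le_bigmax _ _ _ _ (fun ij : 'I_1 * 'I_N => `|x ij.1 ij.2|) (0, i)).
Qed.

Lemma norm_rV_le (x : vec) (e : R) : 0 <= e -> (forall i, `|x 0 i| <= e) ->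
  `|x| <= e.
Proof.
move=> e0 xe; rewrite [leLHS]/Num.Def.normr/= mx_normrE.
by rewrite (bigmax_le _ e0)//= => -[i j] _; rewrite ord1.
Qed.

Lemma norm_delta_le i : `|delta_mx 0 i : vec| <= 1.
Proof.
by apply: norm_rV_le => // j; rewrite mxE eqxx /=; case: eqP; rewrite ?normr1 ?normr0.
Qed.

Lemma ball_segment c (rho : R) u h t : ball c rho u -> ball c rho (u + h) ->
  0 <= t <= 1 -> ball c rho (u + t *: h).
Proof.
rewrite -!ball_normE /= => cu cuh /andP[t0 t1].
have -> : c - (u + t *: h) = (1 - t) *: (c - u) + t *: (c - (u + h)).
  by apply/rowP => k; rewrite !mxE; ring.
(* Strictness of the inequality comes from the second summand, whose weight [t] must not vanish. *)
have [t_eq0|tN0] := eqVneq t 0.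
  by rewrite t_eq0 subr0 scale1r scale0r addr0.
rewrite (le_lt_trans (ler_normD _ _))// !normrZ ger0_norm ?subr_ge0// ger0_norm//.
have -> : rho = (1 - t) * rho + t * rho by ring.
apply: ler_ltD; first by rewrite ler_wpM2l ?subr_ge0// ltW.
by rewrite ltr_pM2l// lt_neqAle eq_sym tN0.
Qed.

Lemma is_derive_line f u h t : differentiable f (u + t *: h) ->
  is_derive t 1 (fun s : R => f (u + s *: h)) ('D_h f (u + t *: h)).
Proof.
move=> df.
have E : (fun k : R => k^-1 *: ((fun s : R => f (u + s *: h)) (k *: 1 + t)
      - f (u + t *: h))) =
    (fun k => k^-1 *: (f (k *: h + (u + t *: h)) - f (u + t *: h))).
  apply/funext => k; rewrite [k *: 1]mulr1 scalerDl.
  by rewrite addrCA.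
have := diff_derivable (v := h) df.
by move=> dfh; apply: DeriveDef; rewrite /derivable /derive /= E.
Qed.

Lemma pd_affine f c (p : R) u : differentiable f (c + p *: u) ->
  differentiable (fun v => f (c + p *: v)) u /\
  forall i, pd i (fun v => f (c + p *: v)) u = p * pd i f (c + p *: u).
Proof.
move=> df.
have da : differentiable (fun v : vec => c + p *: v) u.
  by apply: differentiableD => //; exact: differentiableZ.
have dfa : differentiable (f \o (fun v : vec => c + p *: v)) u.
  exact: differentiable_comp.
split=> // i; rewrite /pd.
rewrite -[LHS]/('D_(delta_mx 0 i) (f \o (fun v : vec => c + p *: v)) u).
rewrite deriveE // diff_comp //=.
have -> : 'd (fun v : vec => c + p *: v) u (delta_mx 0 i) = p *: delta_mx 0 i.
  have H : is_derive u (delta_mx 0 i) (cst c + p \*: id)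
    (0 + p *: delta_mx 0 i) by exact: is_deriveD.
  by rewrite -deriveE // -[RHS]add0r -(@derive_val _ _ _ _ _ _ _ H).
by rewrite linearZ /= deriveE.
Qed.

Lemma mean_value f u h :
  (forall t, 0 <= t <= 1 -> differentiable f (u + t *: h)) ->
  exists2 t, 0 <= t <= 1 &
    f (u + h) - f u = \sum_i h 0 i * pd i f (u + t *: h).
Proof.
move=> df.
have [||t] := @MVT_segment R (fun t => f (u + t *: h))
  (fun t => 'D_h f (u + t *: h)) 0 1 ler01.
- move=> t /[!in_itv]/= /andP[/ltW t0 /ltW t1]; apply: is_derive_line.
  by apply: df; rewrite t0.
- apply: derivable_within_continuous => t /[!in_itv]/= /df /is_derive_line dt.
  exact: ex_derive.
rewrite in_itv/= => t01; rewrite scale1r scale0r addr0 subr0 mulr1 => ->.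
by exists t => //; rewrite derive_pd //; exact: df.
Qed.

Lemma mean_value_ball f c (rho : R) u v :
  (forall x, ball c rho x -> differentiable f x) ->
  ball c rho u -> ball c rho v -> exists t, [/\ 0 <= t <= 1,
    ball c rho (u + t *: (v - u)) &
    f v - f u = \sum_i (v - u) 0 i * pd i f (u + t *: (v - u))].
Proof.
move=> df cu cv.
have seg t : 0 <= t <= 1 -> ball c rho (u + t *: (v - u)).
  by apply: ball_segment => //; rewrite addrC subrK.
have [|t t01 ft] := @mean_value f u (v - u).
  by move=> t /seg; exact: df.
by exists t; split=> //; [exact: seg|rewrite -ft [u + (v - u)]addrC subrK].
Qed.

Lemma mean_value_delta f u i s :
  (forall t, 0 <= t <= 1 -> differentiable f (u + t *: (s *: delta_mx 0 i))) ->
  exists2 t, 0 <= t <= 1 &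
    f (u + s *: delta_mx 0 i) - f u = s * pd i f (u + t *: (s *: delta_mx 0 i)).
Proof.
move=> df; have [t t01 ->] := mean_value df; exists t => //.
rewrite (bigD1 i) //= big1 ?addr0 => [|j ji]; rewrite !mxE eqxx /= ?eqxx ?mulr1 //.
by rewrite (negbTE ji) mulr0 mul0r.
Qed.

(** The mean value theorem is used twice: in direction [i] for the increment of [f] by [s] along
    [j], then in direction [j] for [pd i f]. The far corner [v] is given by an equation, so that the
    lemma with [i] and [j] exchanged speaks of the same point. *)
Lemma second_difference D f u (s : R) i j v : open D -> smooth D f ->
  0 <= s -> (forall x, `|x - u| <= s + s -> D x) ->
  v = u + s *: delta_mx 0 i + s *: delta_mx 0 j ->
  exists2 x, `|x - u| <= s + s &
    f v - f (u + s *: delta_mx 0 i) - (f (u + s *: delta_mx 0 j) - f u)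
    = s * (s * pd j (pd i f) x).
Proof.
move=> oD sf s0 Ds ->.
have bnd (k : 'I_N) (a : R) : 0 <= a <= 1 -> `|a *: (s *: delta_mx 0 k : vec)| <= s.
  move=> /andP[a0 a1]; rewrite !normrZ (ger0_norm a0) (ger0_norm s0).
  rewrite mulrCA ler_piMr // mulr_ile1 //; exact: norm_delta_le.
have near1 (a b : R) : 0 <= a <= 1 -> 0 <= b <= 1 ->
    `|u + a *: (s *: delta_mx 0 i) + b *: (s *: delta_mx 0 j) - u| <= s + s.
  move=> a01 b01; rewrite -[u + _ + _]addrA [u + _]addrC addrK.
  by rewrite (le_trans (ler_normD _ _))// lerD// bnd.
have o1 : 0 <= (1 : R) <= 1 by rewrite ler01 lexx.
have o0 : 0 <= (0 : R) <= 1 by rewrite ler01 lexx.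
have dsh (w x : vec) (g : vec -> R) : differentiable g (x + w) ->
    differentiable (fun x => g (x + w)) x /\
    forall k, pd k (fun x => g (x + w)) x = pd k g (x + w).
  have -> : (fun x => g (x + w)) = (fun x => g (w + 1 *: x)).
    by apply/funext => y; rewrite scale1r addrC.
  move=> dg; have [|dg' pg] := @pd_affine g w 1 x; first by rewrite scale1r addrC.
  by split=> // k; rewrite pg mul1r scale1r addrC.
pose g x := f (x + s *: delta_mx 0 j) - f x.
have dg (t : R) : 0 <= t <= 1 ->
    [/\ D (u + t *: (s *: delta_mx 0 i) + s *: delta_mx 0 j),
        D (u + t *: (s *: delta_mx 0 i)) &
        differentiable g (u + t *: (s *: delta_mx 0 i))].
  move=> t01; have D1 : D (u + t *: (s *: delta_mx 0 i) + s *: delta_mx 0 j).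
    by apply: Ds; have := near1 t 1 t01 o1; rewrite scale1r.
  have D2 : D (u + t *: (s *: delta_mx 0 i)).
    by apply: Ds; have := near1 t 0 t01 o0; rewrite scale0r addr0.
  split=> //; apply: differentiableB; last exact: smooth_differentiable sf D2.
  by have [] := dsh _ _ _ (smooth_differentiable sf D1).
have [|t t01 gt] := @mean_value_delta g u i s.
  by move=> t /dg[].
have [D1 D2 _] := dg t t01.
have [|t' t'01 ft] := @mean_value_delta (pd i f) (u + t *: (s *: delta_mx 0 i)) j s.
  move=> t' t'01; apply: (smooth_differentiable (smooth_pd i sf)).
  by apply: Ds; exact: near1.
exists (u + t *: (s *: delta_mx 0 i) + t' *: (s *: delta_mx 0 j)).
  exact: near1.
rewrite -ft; move: gt; rewrite {1 2}/g => ->; congr (_ * _).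
have [df1 pf1] := dsh _ _ _ (smooth_differentiable sf D1).
by rewrite [LHS](pdB i df1 (smooth_differentiable sf D2)) pf1.
Qed.

(** Both mixed derivatives, taken at suitable points near [u], equal the same second difference
    divided by [s ^ 2]; continuity at [u] concludes. *)
Lemma pd_comm D f i j u : open D -> smooth D f -> D u ->
  pd i (pd j f) u = pd j (pd i f) u.
Proof.
have close (e a b c c' : R) :
    `|a - b| <= e / 2 -> `|c - c'| <= e / 2 -> c' = b -> `|a - c| <= e.
  by rewrite !ler_norml => /andP[? ?] /andP[? ?] ?; apply/andP; split; lra.
move=> oD sf Du; apply/eqP; rewrite -subr_eq0 -normr_le0.
apply/ler_addgt0Pr => e e0; rewrite add0r.
have ct (k l : 'I_N) : {for u, continuous (pd k (pd l f))}.
  apply: differentiable_continuous; apply: (smooth_differentiable _ Du).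
  by do 2!apply: smooth_pd.
have e2 : 0 < e / 2 by rewrite divr_gt0.
have /nbhs_ballP[d0 d00 bD] : nbhs u D by exact: open_nbhs_nbhs.
have /nbhs_ballP[d1 d10 b1] :
    nbhs u [set x | `|pd i (pd j f) u - pd i (pd j f) x| <= e / 2].
  by move: (ct i j) => /cvgrPdist_le; apply.
have /nbhs_ballP[d2 d20 b2] :
    nbhs u [set x | `|pd j (pd i f) u - pd j (pd i f) x| <= e / 2].
  by move: (ct j i) => /cvgrPdist_le; apply.
pose d := Num.min d0 (Num.min d1 d2).
have dgt0 : 0 < d by rewrite !lt_min d00 d10 d20.
(* Points of the square are within [s + s] of [u], and this has to stay below [d]. *)
pose s := d / 3.
have s0 : 0 < s by rewrite divr_gt0.
have ss : s + s < d by rewrite /s; lra.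
have inb x : `|x - u| <= s + s -> [/\ ball u d0 x, ball u d1 x & ball u d2 x].
  move=> xu; have : `|u - x| < d by rewrite distrC (le_lt_trans xu).
  by rewrite !lt_min -!ball_normE => /and3P[].
have Ds x : `|x - u| <= s + s -> D x by move=> /inb[/bD].
have [x /inb[_ _ bx] fx] :=
  @second_difference D f u s i j _ oD sf (ltW s0) Ds (erefl _).
have [y /inb[_ by_ _] fy] :=
  second_difference oD sf (ltW s0) Ds (addrAC u (s *: delta_mx 0 i) (s *: delta_mx 0 j)).
have E (p q r t a b : R) :
    p - q - (r - t) = s * (s * a) -> p - r - (q - t) = s * (s * b) -> a = b.
  move=> pa pb; apply: (mulfI (lt0r_neq0 s0)); apply: (mulfI (lt0r_neq0 s0)).
  by rewrite -pa -pb; ring.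
exact: (close _ _ _ _ _ (b1 y by_) (b2 x bx) (E _ _ _ _ _ _ fx fy)).
Qed.

End MeanValue.

(** * Estimates for finite sums and for one Euler step *)

Section FiniteSums.
Variable R : realType.

Lemma norm_sum_le (I : finType) (F : I -> R) (B : R) :
  (forall i, `|F i| <= B) -> `|\sum_i F i| <= #|I|%:R * B.
Proof.
move=> FB; rewrite (le_trans (ler_norm_sum _ _ _))//.
rewrite (le_trans (ler_sum _ (fun i _ => FB i)))//.
by rewrite sumr_const mulr_natl cardE.
Qed.

Lemma normM_le (a b p q : R) : `|a| <= p -> `|b| <= q -> `|a * b| <= p * q.
Proof. by move=> ap bq; rewrite normrM ler_pM. Qed.

(** Since [k < 2 ^ k], a positive [x - a] would have all its multiples [(x - a) * k] bounded by
    [K]. *)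
Lemma le_of_half_powers (x a K : R) :
  (forall k, x <= a + K / 2 ^+ k) -> x <= a.
Proof.
move=> xk; rewrite leNgt; apply/negP => ax.
have d0 : 0 < x - a by rewrite subr_gt0.
have Kd k : (x - a) * k%:R <= K.
  have := xk k; rewrite -lerBlDl ler_pdivlMr ?exprn_gt0//.
  apply: le_trans; rewrite ler_wpM2l ?ltW//.
  by rewrite -natrX ltr_nat ltn_expl.
have K0 : 0 <= K / (x - a) 
  by apply: divr_ge0 (ltW d0); rewrite (le_trans _ (Kd 1%N))// mulr1 ltW.
have := archi_boundP K0; rewrite ltr_pdivrMr// mulrC => /lt_le_trans /(_ (Kd _)).
by rewrite ltxx.
Qed.

(* One Euler step for the defect [dy - p A_i y] of an approximate solution:
   when the connection is flat the terms of first order in h other than z drop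
   out.  Here y is the current value, dy its i-th partial derivative, Ai and
   Ai' the i-th coefficient matrix at two consecutive nodes. *)
Lemma euler_defect (I J : finType) (h p : R) (w : I -> R) (Aj dAj : I -> J -> J -> R)
    (Ai Ai' : J -> J -> R) (dAi : I -> J -> J -> R) (y dy z L W : J -> R) (a : J) :
  (forall j b, dAj j a b - dAi j a b
     + \sum_c (Aj j a c * Ai c b - Ai a c * Aj j c b) = 0) ->
  (forall b, L b = \sum_(q : I * J) w q.1 * Aj q.1 b q.2 * y q.2) ->
  (forall b, W b = \sum_j w j * dAi j a b) ->
  (forall b, z b = dy b - p * \sum_c Ai b c * y c) ->
  (dy a + h * (\sum_b Ai a b * y b
       + p * (\sum_(q : I * J) w q.1 * dAj q.1 a q.2 * y q.2)
       + \sum_(q : I * J) w q.1 * Aj q.1 a q.2 * dy q.2))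
    - (p + h) * (\sum_b Ai' a b * (y b + h * L b))
  = z a + h * (\sum_(q : I * J) w q.1 * Aj q.1 a q.2 * z q.2)
    - h ^+ 2 * (\sum_b Ai a b * L b + \sum_b W b * y b)
    - (p + h) * (h ^+ 2 * (\sum_b W b * L b)
        + \sum_b (Ai' a b - Ai a b - h * W b) * (y b + h * L b)).
Proof.
move=> flat defL defW defz.
pose T1 := \sum_(q : I * J) w q.1 * Aj q.1 a q.2 * \sum_c Ai q.2 c * y c.
have E1 : \sum_(q : I * J) w q.1 * Aj q.1 a q.2 * dy q.2 =
    \sum_(q : I * J) w q.1 * Aj q.1 a q.2 * z q.2 + p * T1.
  rewrite /T1 mulr_sumr -big_split; apply: eq_bigr => q _ /=.
  by rewrite defz; ring.
have E2 : \sum_b Ai' a b * (y b + h * L b) =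
    \sum_b Ai a b * y b + h * (\sum_b Ai a b * L b) + h * (\sum_b W b * y b)
    + h ^+ 2 * (\sum_b W b * L b)
    + \sum_b (Ai' a b - Ai a b - h * W b) * (y b + h * L b).
  rewrite !mulr_sumr -!big_split; apply: eq_bigr => b _ /=; ring.
have pairs (F : I -> J -> R) : \sum_(q : I * J) F q.1 q.2 = \sum_j \sum_b F j b.
  by rewrite pair_bigA.
(* The terms of first order: this is the flatness identity contracted with [w] and [y]. *)
have E3 : \sum_(q : I * J) w q.1 * dAj q.1 a q.2 * y q.2 - \sum_b W b * y b
    + T1 - \sum_b Ai a b * L b = 0.
  have F1 : T1 = \sum_(q : I * J) w q.1 * y q.2 * \sum_c Aj q.1 a c * Ai c q.2.
    rewrite /T1 (pairs (fun j b => w j * Aj j a b * \sum_c Ai b c * y c)).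
    rewrite (pairs (fun j b => w j * y b * \sum_c Aj j a c * Ai c b)).
    apply: eq_bigr => j _.
    under eq_bigr do rewrite mulr_sumr.
    under [RHS]eq_bigr do rewrite mulr_sumr.
    rewrite exchange_big; apply: eq_bigr => b _; apply: eq_bigr => c _; ring.
  have F2 : \sum_b Ai a b * L b =
      \sum_(q : I * J) w q.1 * y q.2 * \sum_c Ai a c * Aj q.1 c q.2.
    under eq_bigr do rewrite defL mulr_sumr.
    rewrite exchange_big; apply: eq_bigr => q _ /=; rewrite mulr_sumr.
    apply: eq_bigr => c _; ring.
  have F3 : \sum_b W b * y b = \sum_(q : I * J) w q.1 * y q.2 * dAi q.1 a q.2.
    rewrite (pairs (fun j b => w j * y b * dAi j a b)) exchange_big.
    apply: eq_bigr => b _; rewrite defW mulr_suml; apply: eq_bigr => j _; ring.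
  rewrite F1 F2 F3 -sumrB -big_split -sumrB big1 // => q _ /=.
  have key (s t p1 p2 v v' : R) : p1 - p2 + (s - t) = 0 ->
      v * p1 * v' - v * v' * p2 + v * v' * s - v * v' * t = 0.
    move=> H; transitivity (v * v' * (p1 - p2 + (s - t))); first ring.
    by rewrite H mulr0.
  by apply: key; have := flat q.1 q.2; rewrite sumrB.
rewrite E1 E2.
have -> : dy a = z a + p * \sum_b Ai a b * y b by rewrite defz subrK.
have key (x s1 s2 s4 s5 s6 s7 t1 t2 : R) : s2 - s4 + t1 - t2 = 0 ->
    x + p * s1 + h * (s1 + p * s2 + (s7 + p * t1))
      - (p + h) * (s1 + h * t2 + h * s4 + h ^+ 2 * s5 + s6)
    = x + h * s7 - h ^+ 2 * (t2 + s4) - (p + h) * (h ^+ 2 * s5 + s6).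
  move=> H; have -> : s2 = s4 - t1 + t2 by rewrite -[s2]subr0 -H; ring.
  ring.
exact: key E3.
Qed.

(** By the smallness hypothesis, the sum over pairs weighted by [w] and [Aj] is at most half the
    bound of the summed values. This gives the factor [1 + h / 2] for the defect and [Y + Y] for the
    next value [y + h L]. All remaining terms of [euler_defect] carry [h ^ 2], and [p + h] is at
    most 1. *)
Lemma euler_defect_le (I J : finType) (h p rho M Y B C : R) (w : I -> R)
    (Aj dAj : I -> J -> J -> R) (Ai Ai' : J -> J -> R) (dAi : I -> J -> J -> R)
    (y dy : J -> R) (a : J) :
  let L b := \sum_(q : I * J) w q.1 * Aj q.1 b q.2 * y q.2 in
  let z b := dy b - p * \sum_c Ai b c * y c in
  (forall j b, dAj j a b - dAi j a b
     + \sum_c (Aj j a c * Ai c b - Ai a c * Aj j c b) = 0) ->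
  (#|{: I * J}|)%:R * (rho * M) <= 2^-1 ->
  0 <= h <= 1 -> 0 <= p + h <= 1 ->
  (forall j, `|w j| <= rho) -> (forall j b c, `|Aj j b c| <= M) ->
  (forall b c, `|Ai b c| <= M) -> (forall j b c, `|dAi j b c| <= M) ->
  (forall b, `|Ai' a b - Ai a b - h * \sum_j w j * dAi j a b| <= h ^+ 2 * C) ->
  (forall b, `|y b| <= Y) -> (forall b, `|z b| <= B) ->
  `|(dy a + h * (\sum_b Ai a b * y b
       + p * (\sum_(q : I * J) w q.1 * dAj q.1 a q.2 * y q.2)
       + \sum_(q : I * J) w q.1 * Aj q.1 a q.2 * dy q.2))
    - (p + h) * (\sum_b Ai' a b * (y b + h * L b))|
  <= (1 + h / 2) * B + h ^+ 2 * (#|J|%:R * (M * Y)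
       + (#|J|%:R * (#|I|%:R * (rho * M) * Y)) *+ 2 + #|J|%:R * (C * (Y + Y))).
Proof.
move=> L z flat small /andP[h0 h1] /andP[ph0 ph1] wr AjM AiM dAiM AiC yY zB.
rewrite (@euler_defect I J h p w Aj dAj Ai Ai' dAi y dy z L
  (fun b => \sum_j w j * dAi j a b)) //.
have Y0 : 0 <= Y by apply: le_trans (normr_ge0 _) (yY a).
have B0 : 0 <= B by apply: le_trans (normr_ge0 _) (zB a).
have halve (x : J -> R) X b : (forall b, `|x b| <= X) ->
    `|\sum_(q : I * J) w q.1 * Aj q.1 b q.2 * x q.2| <= X / 2.
  move=> xX; have X0 : 0 <= X by apply: le_trans (normr_ge0 _) (xX b).
  apply: le_trans (norm_sum_le (B := rho * M * X) _) _ => [q|].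
    by do 2?apply: normM_le.
  by rewrite mulrA mulrC ler_wpM2l.
have LY b : `|L b| <= Y by apply: le_trans (halve _ _ b yY) _; lra.
have Wr b : `|\sum_j w j * dAi j a b| <= #|I|%:R * (rho * M).
  by apply: norm_sum_le => j; exact: normM_le.
have S1 : `|\sum_b Ai a b * L b| <= #|J|%:R * (M * Y).
  by apply: norm_sum_le => b; exact: normM_le.
have S2 (x : J -> R) : (forall b, `|x b| <= Y) ->
    `|\sum_b (\sum_j w j * dAi j a b) * x b| <= #|J|%:R * (#|I|%:R * (rho * M) * Y).
  by move=> xY; apply: norm_sum_le => b; exact: normM_le.
have S3 : `|\sum_b (Ai' a b - Ai a b - h * \sum_j w j * dAi j a b) * (y b + h * L b)|
    <= h ^+ 2 * (#|J|%:R * (C * (Y + Y))).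
  have -> : h ^+ 2 * (#|J|%:R * (C * (Y + Y))) = #|J|%:R * (h ^+ 2 * C * (Y + Y)) by ring.
  apply: norm_sum_le => b; apply: normM_le => //.
  rewrite (le_trans (ler_normD _ _))// lerD// normrM ger0_norm//.
  by rewrite -[leRHS]mul1r ler_pM.
have key (x1 x2 x3 x4 x5 x6 b2 b3 b4 : R) : `|x1| <= B -> `|x2| <= B / 2 ->
    `|x3| <= b3 -> `|x4| <= b4 -> `|x5| <= b4 -> `|x6| <= h ^+ 2 * b2 ->
    `|x1 + h * x2 - h ^+ 2 * (x3 + x4) - (p + h) * (h ^+ 2 * x5 + x6)|
    <= (1 + h / 2) * B + h ^+ 2 * (b3 + b4 *+ 2 + b2).
  move=> n1 n2 n3 n4 n5 n6; have hh : 0 <= h ^+ 2 by rewrite exprn_ge0.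
  have m2 : `|h * x2| <= h * (B / 2) by rewrite normrM ger0_norm ?ler_wpM2l.
  have m3 : `|h ^+ 2 * (x3 + x4)| <= h ^+ 2 * (b3 + b4).
    by rewrite normrM ger0_norm// ler_wpM2l// (le_trans (ler_normD _ _))// lerD.
  have m5 : `|(p + h) * (h ^+ 2 * x5 + x6)| <= h ^+ 2 * b4 + h ^+ 2 * b2.
    rewrite normrM (ger0_norm ph0) -[leRHS]mul1r ler_pM//.
    rewrite (le_trans (ler_normD _ _))// lerD// normrM ger0_norm//.
    by rewrite ler_wpM2l.
  apply: le_trans (ler_normB _ _) _.
  have -> : (1 + h / 2) * B + h ^+ 2 * (b3 + b4 *+ 2 + b2) =
    (B + h * (B / 2) + h ^+ 2 * (b3 + b4)) + (h ^+ 2 * b4 + h ^+ 2 * b2) by ring.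
  apply: lerD m5; apply: le_trans (ler_normB _ _) _; apply: lerD m3.
  by apply: le_trans (ler_normD _ _) _; exact: lerD.
apply: key (zB a) (halve _ _ a zB) S1 (S2 y yY) (S2 L LY) S3.
Qed.

End FiniteSums.

(** * Total linear systems: a priori estimate and uniqueness *)

Section LinearSystems.
Variables (R : realType) (N : nat) (J : finType).
Local Notation vec := 'rV[R]_N.
Implicit Types (D : set vec) (c u v : vec) (A : 'I_N -> J -> J -> vec -> R).
Implicit Types (y : J -> vec -> R).

Definition total_linear D A y := forall a u, D u -> differentiable (y a) u /\
  forall i, pd i (y a) u = \sum_b A i a b u * y b u.

(** The integrability condition: equality of [d_i d_j y] and [d_j d_i y], both computed from
    [total_linear], as an identity between coefficient matrices. *)
Definition flat_connection D A := forall i j a b u, D u ->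
  pd i (A j a b) u - pd j (A i a b) u
  + \sum_c (A j a c u * A i c b u - A i a c u * A j c b u) = 0.

Lemma near_bounded (I : finType) (F : I -> vec -> R) c :
  (forall i, {for c, continuous (F i)}) ->
  exists2 M, 0 < M & \forall u \near c, forall i, `|F i u| <= M.
Proof.
move=> cF; exists (1 + \sum_i `|F i c|).
  by rewrite ltr_pwDl// sumr_ge0.
pose P i : set vec := [set u | `|F i u| <= 1 + \sum_i `|F i c|].
apply: (@filter_forall _ _ P (nbhs c) _) => i.
have /cvgrPdist_le /(_ 1 ltr01) := cF i; apply: filterS => u cu.
rewrite /P /= -[F i u](subrK (F i c)) (le_trans (ler_normD _ _))//.
rewrite lerD ?(distrC (F i u))//.
by rewrite (bigD1 i)//= lerDl sumr_ge0.
Qed.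

Lemma ball_coord c (rho : R) u i : ball c rho u -> `|(u - c) 0 i| <= rho.
Proof.
rewrite -ball_normE /= distrC => /ltW; apply: le_trans; exact: ler_norm_coord.
Qed.

(** The mean value theorem from the centre, where [y] vanishes, improves a bound [K'] to
    [N rho e + K' / 2]. Iteration drives any initial bound [K] down to the fixed point [2 N rho e]
    of this map. *)
Lemma linear_estimate A y c (rho M e K : R) :
  (#|{: 'I_N * J}|)%:R * (rho * M) <= 2^-1 -> 0 < rho -> 0 <= e ->
  (forall i a b u, ball c rho u -> `|A i a b u| <= M) ->
  (forall a u, ball c rho u -> differentiable (y a) u) ->
  (forall a, y a c = 0) ->
  (forall a u, ball c rho u -> `|y a u| <= K) ->
  (forall i a u, ball c rho u -> `|pd i (y a) u - \sum_b A i a b u * y b u| <= e) ->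
  forall a u, ball c rho u -> `|y a u| <= (N%:R * (rho * e)) *+ 2.
Proof.
move=> small rho0 e0 AM dy yc yK ye.
have cc : ball c rho c by exact: ballxx.
have step (K' : R) : (forall a u, ball c rho u -> `|y a u| <= K') ->
    forall a u, ball c rho u -> `|y a u| <= N%:R * (rho * e) + K' / 2.
  move=> yK' a u cu.
  have [t [_ bx]] := mean_value_ball (dy a) cc cu; rewrite yc subr0 => ->.
  set x := c + t *: (u - c) in bx *.
  have py i : `|pd i (y a) x| <= e + #|J|%:R * (M * K').
    rewrite -[pd i (y a) x](subrK (\sum_b A i a b x * y b x)).
    rewrite (le_trans (ler_normD _ _))// lerD ?ye//.
    by apply: norm_sum_le => b; apply: normM_le; [exact: AM|exact: yK'].
  apply: le_trans (norm_sum_le (B := rho * (e + #|J|%:R * (M * K'))) _) _ => [i|].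
    by apply: normM_le => //; exact: ball_coord.
  have K'0 : 0 <= K' by apply: le_trans (normr_ge0 _) (yK' a u cu).
  rewrite card_ord !mulrDr lerD2l mulrC.
  by move: small; rewrite card_prod card_ord natrM => /(ler_wpM2r K'0); lra.
move=> a u cu; apply: (@le_of_half_powers _ _ _ K) => k.
elim: k a u cu => [|k IH] a u cu.
  rewrite expr0 divr1 (le_trans (yK a u cu))// lerDr mulrn_wge0//.
  by rewrite mulr_ge0// mulr_ge0// ltW.
apply: le_trans (step _ IH a u cu) _.
by rewrite exprS invfM mulr2n; move: (_ ^-1) (N%:R * _) => p q; lra.
Qed.

Lemma small_radius c (P : set vec) (M : R) : nbhs c P -> 0 < M ->
  exists2 rho : R, 0 < rho <= 1 &
    ball c rho `<=` P /\ (#|{: 'I_N * J}|)%:R * (rho * M) <= 2^-1.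
Proof.
move=> /nbhs_ballP[d d0 dP] M0.
pose n : R := (#|{: 'I_N * J}|)%:R; have n0 : 0 <= n by exact: ler0n.
(* The [+ 1] keeps the denominator positive when there are no pairs of indices. *)
pose q := (2 * (n * M + 1))^-1.
have nM : 0 <= n * M by rewrite mulr_ge0// ltW.
have q0 : 0 < q by rewrite invr_gt0 mulr_gt0// ltr_wpDl.
pose rho := Num.min 1 (Num.min d q).
have rho1 : rho <= 1 by rewrite ge_min lexx.
have rhod : rho <= d by rewrite !ge_min lexx orbT.
have rhoq : rho <= q by rewrite !ge_min lexx !orbT.
exists rho; first by rewrite rho1 andbT !lt_min ltr01 d0 q0.
split; first exact: subset_trans (le_ball rhod) dP.
rewrite -/n mulrCA (le_trans (ler_wpM2r nM rhoq))//.
rewrite /q invfM -mulrA ler_piMr// mulrC ler_pdivrMr ?mul1r ?lerDl//.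
by rewrite ltr_wpDl.
Qed.

(** The zero set is open by [linear_estimate] with [e = 0], and closed in [D] by continuity;
    connectedness makes it all of [D]. *)
Lemma total_linear_unique D A y u0 : open D -> connected D ->
  (forall i a b u, D u -> {for u, continuous (A i a b)}) ->
  total_linear D A y -> D u0 -> (forall a, y a u0 = 0) ->
  forall u, D u -> forall a, y a u = 0.
Proof.
move=> oD coD cA yA Du0 y0.
have cy a u : D u -> {for u, continuous (y a)}.
  by move=> Du; apply: differentiable_continuous; have [] := yA a u Du.
have local c : D c -> (forall a, y a c = 0) ->
    \forall u \near c, forall a, y a u = 0.
  move=> Dc yc.
  have [M M0 AM] := @near_bounded _ (fun q : 'I_N * J * J => A q.1.1 q.1.2 q.2) c
    (fun q => cA _ _ _ c Dc).
  have [K K0 yK] := @near_bounded _ y c (fun a => cy a c Dc).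
  have nD : nbhs c D by exact: open_nbhs_nbhs.
  have [rho /andP[rho0 _] [sub small]] := small_radius (filterI nD (filterI AM yK)) M0.
  apply/nbhs_ballP; exists rho => // u cu a.
  have := @linear_estimate A y c rho M 0 K small rho0 (lexx _) _ _ yc _ _ a u cu.
  rewrite !mulr0 mul0rn => H; apply/eqP; rewrite -normr_le0; apply: H.
  - by move=> i b b' v /sub[_ [Av _]]; exact: (Av (i, b, b')).
  - by move=> b v /sub[Dv _]; have [] := yA b v Dv.
  - by move=> b v /sub[_ [_]].
  - move=> i b v /sub[Dv _]; have [_ ->] := yA b v Dv.
    by rewrite subrr normr0.
pose Z := [set u | D u /\ forall a, y a u = 0].
suff ZD : Z = D by move=> u; rewrite -ZD => -[].
apply: coD; first by exists u0.
- exists (interior Z); first exact: open_interior.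
  apply/seteqP; split=> [u [Du yu]|u [_ /interior_subset]] //; split=> //.
  have := local u Du yu; have : nbhs u D by exact: open_nbhs_nbhs.
  by apply: filterS2 => v Dv yv; split.
- exists (closure Z); first exact: closed_closure.
  apply/seteqP; split=> [u [Du yu]|u [Du cu]].
    by split=> //; apply: subset_closure; split.
  split=> // a; apply/eqP/negPn/negP => yN0.
  have := cy a u Du => /cvgrPdist_lt /(_ `|y a u|); rewrite normr_gt0 => /(_ yN0).
  by move=> /cu[v [[Dv yv]]] /=; rewrite yv subr0 ltxx.
Qed.

(** The mean value theorem for [f], then for its partial derivatives; each use contributes a factor
    [N * d]. *)
Lemma taylor1 f c (rho M d : R) u v :
  (forall x, ball c rho x -> differentiable f x) ->
  (forall j x, ball c rho x -> differentiable (pd j f) x) ->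
  (forall j k x, ball c rho x -> `|pd k (pd j f) x| <= M) ->
  ball c rho u -> ball c rho v -> (forall j, `|(v - u) 0 j| <= d) -> 0 <= d ->
  `|f v - f u - \sum_j (v - u) 0 j * pd j f u| <= N%:R * (d * (N%:R * (d * M))).
Proof.
move=> df ddf ddM cu cv vd d0.
have [t [/andP[t0 t1] cx ->]] := mean_value_ball df cu cv.
have NE : N%:R = #|'I_N|%:R :> R by rewrite card_ord.
rewrite -sumrB NE.
apply: norm_sum_le => j; rewrite -mulrBr; apply: normM_le => //.
have [s [/andP[s0 s1] cz ->]] := mean_value_ball (ddf j) cu cx.
apply: norm_sum_le => k; apply: normM_le.
  rewrite addrC addKr mxE normrM ger0_norm// (le_trans _ (vd k))// ler_piMl//.
exact: ddM.
Qed.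

End LinearSystems.

(** * Differentiability of a uniform limit with uniformly convergent gradients *)

Section UniformLimit.
Variables (R : realType) (N : nat).
Local Notation vec := 'rV[R]_N.

Lemma uniform_limit_differentiable (f : vec -> R) (g : 'I_N -> vec -> R)
    (c : vec) (rho : R) :
  (forall i u, ball c rho u -> {for u, continuous (g i)}) ->
  (forall e, 0 < e -> exists F : vec -> R, forall u, ball c rho u ->
     [/\ differentiable F u, `|F u - f u| <= e
       & forall i, `|pd i F u - g i u| <= e]) ->
  forall u, ball c rho u ->
    differentiable f u /\ forall i, pd i f u = g i u.
Proof.
move=> cg Ff v cv.
pose L (x : vec) := \sum_i x 0 i * g i v.
have linL : linear L.
  move=> a x y; rewrite /L scaler_sumr -big_split; apply: eq_bigr => i _ /=.
  by rewrite !mxE mulrDl -mulrA.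
pose LM := GRing.isLinear.Build R vec R _ L linL.
pose LL : {linear vec -> R} := HB.pack L LM.
have cL : continuous LL.
  move=> x; apply: differentiable_continuous.
  apply: differentiable_fsum => i.
  apply: (@differentiableM R vec (fun x => x 0 i) (fun=> g i v)).
    exact: differentiable_coord.
  exact: differentiable_cst.
suff approx e : 0 < e -> \forall h \near (0 : vec),
    `|f (h + v) - f v - LL h| <= e * `|h|.
  have [dfv dLv] := differentiable_of_linear_approx cL approx.
  split=> // i; rewrite /pd deriveE // dLv /= /L (bigD1 i) //= big1 => [|j ji].
    by rewrite !mxE !eqxx mul1r addr0.
  by rewrite !mxE eqxx (negbTE ji) mul0r.
(* The total error is [2 N e'] from the gradients and [2 e'] from the values, each times the norm of
   [h]. *)
move=> e0; pose e' := e / (2 * (N%:R + 1)).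
have N0 : 0 <= N%:R :> R by exact: ler0n.
have e'0 : 0 < e' by rewrite divr_gt0// mulr_gt0// ltr_wpDl.
have vB : nbhs v (ball c rho).
  by apply: open_nbhs_nbhs; split=> //; exact: ball_open.
pose P i : set vec := [set x | `|g i v - g i x| <= e'].
have vP : \forall x \near v, forall i, P i x.
  apply: (@filter_forall _ _ P (nbhs v) _) => i.
  by have /cvgrPdist_le := cg i v cv; apply.
have /nbhs_ballP[d d0 bP] : nbhs v (ball c rho `&` [set x | forall i, P i x]).
  exact: filterI.
apply/nbhs_ballP; exists d => // h; rewrite -ball_normE /= sub0r normrN => hd.
have vd : ball v d v by exact: ballxx.
have hvd : ball v d (h + v) by rewrite -ball_normE /= opprD addrCA subrr addr0 normrN.
have [chv _] := bP _ hvd.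
have [->|hN0] := eqVneq h 0.
  by rewrite add0r subrr -[L 0]/(LL 0) linear0 subrr !normr0 mulr0.
have h0 : 0 < `|h| by rewrite normr_gt0.
(* The approximant is chosen after [h]: its values must be accurate relative to the norm of [h], its
   gradient only up to [e']. *)
pose eta := Num.min (e' * `|h|) e'.
have eta0 : 0 < eta by rewrite lt_min mulr_gt0.
have [F FP] := Ff eta eta0.
have dF x : ball v d x -> differentiable F x by move=> /bP[/FP[]].
have [t [_ bx]] := mean_value_ball dF vd hvd.
rewrite addrK in bx *; set x := v + t *: h in bx * => FE.
have [_ Fv _] := FP v cv; have [_ Fhv _] := FP _ chv.
have [/FP[_ _ pF] gx] := bP x bx.
have FL : `|F (h + v) - F v - LL h| <= N%:R * (`|h| * (e' + e')).
  rewrite FE /= /L -sumrB.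
  have -> : N%:R = #|'I_N|%:R :> R by rewrite card_ord.
  apply: norm_sum_le => i; rewrite -mulrBr; apply: normM_le.
    exact: ler_norm_coord.
  rewrite -(subrKA (g i x)) (le_trans (ler_normD _ _))//; apply: lerD.
    by rewrite (le_trans (pF i))// ge_min lexx orbT.
  by rewrite distrC; exact: gx.
have e'e : e = 2 * (N%:R + 1) * e'.
  by rewrite /e' mulrCA divff ?mulr1// mulf_neq0// lt0r_neq0// ltr_wpDl.
have key (n p e1 e2 H f1 f2 F1 F2 l : R) : e1 <= e2 * H -> `|F1 - f1| <= e1 ->
    `|F2 - f2| <= e1 -> `|F1 - F2 - l| <= n * (H * (e2 + e2)) ->
    p = 2 * (n + 1) * e2 -> `|f1 - f2 - l| <= p * H.
  move=> h1 h2 h3 h4 ->; have -> : f1 - f2 - l = (F1 - F2 - l) - (F1 - f1) + (F2 - f2).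
    by ring.
  apply: le_trans (ler_normD _ _) _.
  apply: le_trans (lerD (le_trans (ler_normB _ _) (lerD h4 h2)) h3) _.
  have -> : 2 * (n + 1) * e2 * H = n * (H * (e2 + e2)) + e2 * H + e2 * H by ring.
  by rewrite !lerD.
by apply: key Fhv Fv FL e'e; rewrite ge_min lexx.
Qed.

End UniformLimit.

(** * Euler polygons along rays as approximate solutions *)

Section EulerScheme.
Variables (R : realType) (N : nat) (J : finType).
Local Notation vec := 'rV[R]_N.
Variables (A : 'I_N -> J -> J -> vec -> R) (c : vec) (rho M : R).
Hypothesis dA : forall i a b u, ball c rho u -> differentiable (A i a b) u.
Hypothesis ddA : forall i a b j u, ball c rho u ->
  differentiable (pd j (A i a b)) u.
Hypothesis AM : forall i a b u, ball c rho u -> `|A i a b u| <= M.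
Hypothesis dAM : forall i a b j u, ball c rho u -> `|pd j (A i a b) u| <= M.
Hypothesis ddAM : forall i a b j k u, ball c rho u ->
  `|pd k (pd j (A i a b)) u| <= M.
Hypothesis flatA : flat_connection (ball c rho) A.
Hypothesis rho0 : 0 < rho.
Hypothesis small : (#|{: 'I_N * J}|)%:R * (rho * M) <= 2^-1.

(** The point [c + p (u - c)], expanded into the affine form in [u] that [pd_affine]
    differentiates. *)
Definition ray_point (p : R) (u : vec) : vec := c - p *: c + p *: u.

(* Euler's method with step h along the ray from c to u, for the restriction
   of the system to that ray. *)
Fixpoint euler (y0 : J -> R) (h : R) (k : nat) (a : J) (u : vec) : R :=
  if k is k'.+1 then
    euler y0 h k' a u + h * \sum_(q : 'I_N * J) (u - c) 0 q.1
      * A q.1 a q.2 (ray_point (k'%:R * h) u) * euler y0 h k' q.2 u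
  else y0 a.

Lemma ball_ray_point p u : 0 <= p <= 1 -> ball c rho u ->
  ball c rho (ray_point p u).
Proof.
move=> p01 cu; have -> : ray_point p u = c + p *: (u - c).
  by rewrite /ray_point scalerBr addrAC addrA.
by apply: ball_segment => //; [exact: ballxx|rewrite addrC subrK].
Qed.

Lemma pd_coordB (j i : 'I_N) u :
  differentiable (fun v : vec => (v - c) 0 j) u /\
  pd i (fun v : vec => (v - c) 0 j) u = (i == j)%:R.
Proof.
have E : (fun v : vec => (v - c) 0 j) = (fun v => v 0 j - c 0 j).
  by apply/funext => v; rewrite !mxE.
have dc : differentiable (fun v : vec => v 0 j) u by exact: differentiable_coord.
have dk : differentiable (fun _ : vec => c 0 j) u by exact: differentiable_cst.
rewrite E; split; first exact: differentiableB.
rewrite pdB // pd_cst subr0 (pd_row (r := id)) //.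
by rewrite /pd derive_id mxE eqxx eq_sym.
Qed.

(** The three sums come from differentiating, in this order, the factor [u - c], the node (whence
    [p]) and the preceding polygon. *)
Lemma pd_euler y0 h k : 0 <= k%:R * h <= 1 ->
  (forall a u, ball c rho u -> differentiable (euler y0 h k a) u) ->
  forall a u, ball c rho u -> differentiable (euler y0 h k.+1 a) u /\
    forall i, pd i (euler y0 h k.+1 a) u =
    let p := k%:R * h in let x := ray_point p u in
    pd i (euler y0 h k a) u + h * (\sum_b A i a b x * euler y0 h k b u
       + p * (\sum_(q : 'I_N * J) (u - c) 0 q.1 * pd i (A q.1 a q.2) x
           * euler y0 h k q.2 u)
       + \sum_(q : 'I_N * J) (u - c) 0 q.1 * A q.1 a q.2 x * pd i (euler y0 h k q.2) u).
Proof.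
set p := k%:R * h => p01 dy a u cu; set x := ray_point p u.
have cx : ball c rho x by exact: ball_ray_point.
pose F (q : 'I_N * J) v := (v - c) 0 q.1 * A q.1 a q.2 (ray_point p v).
have dAx q := pd_affine (dA q.1 a q.2 cx).
have dF q : differentiable (F q) u.
  by apply: differentiableM; [have [] := pd_coordB q.1 q.1 u|have [] := dAx q].
have pF q i : pd i (F q) u =
    (u - c) 0 q.1 * (p * pd i (A q.1 a q.2) x) + (i == q.1)%:R * A q.1 a q.2 x.
  have [dc pc] := pd_coordB q.1 i u; have [dAq pAq] := dAx q.
  by rewrite pdM // pc pAq.
pose S v := \sum_(q : 'I_N * J) F q v * euler y0 h k q.2 v.
have dS : differentiable S u.
  by apply: differentiable_fsum => q; apply: differentiableM => //; exact: dy.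
have E : euler y0 h k.+1 a = (fun v => euler y0 h k a v + h *: S v) by [].
rewrite E; split=> [|i].
  by apply: differentiableD; [exact: dy|exact: differentiableZ].
rewrite pdD //; [|exact: dy|exact: differentiableZ].
rewrite pdZ //; congr (_ + _ * _).
rewrite pd_sumM // => [|q]; last exact: dy.
rewrite big_split /= [LHS]addrC; congr (_ + _).
under eq_bigr => q _ do rewrite pF mulrDl.
rewrite big_split /= [LHS]addrC; congr (_ + _).
  have -> : \sum_b A i a b x * euler y0 h k b u =
      \sum_j \sum_b (i == j)%:R * A j a b x * euler y0 h k b u.
    rewrite (bigD1 i) //= [X in _ + X]big1 ?addr0 => [|j ji].
      by apply: eq_bigr => b _; rewrite eqxx mul1r.
    by rewrite big1 // => b _; rewrite eq_sym (negbTE ji) !mul0r.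
  by rewrite pair_bigA.
by rewrite mulr_sumr; apply: eq_bigr => q _; ring.
Qed.

Lemma euler_center y0 h k a : euler y0 h k a c = y0 a.
Proof.
elim: k a => //= k IH a; rewrite IH big1 ?mulr0 ?addr0 // => q _.
by rewrite subrr mxE !mul0r.
Qed.

Definition euler_taylor : R := N%:R * (rho * (N%:R * (rho * M))).

(** The coefficient of [h ^ 2] in [euler_defect_le] for [Y = K + K] and [C = euler_taylor]; the
    latter is the bound of [taylor1] between consecutive nodes, whose coordinates differ by at most
    [h * rho], with [h ^ 2] taken out. *)
Definition euler_const (K : R) : R :=
  #|J|%:R * (M * (K + K))
  + (#|J|%:R * (#|'I_N|%:R * (rho * M) * (K + K))) *+ 2
  + #|J|%:R * (euler_taylor * (K + K + (K + K))).

(** The values stay below [K + K], so by smallness of the radius one step adds at most [h K]. With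
    [E] for [euler_const K], the defect bound reproduces itself because [k h <= 1]: [(1 + h / 2) *
    (k h^2 * 2 E) + h^2 E <= (k + 1) h^2 * 2 E]. *)
Lemma euler_invariant y0 K h (n : nat) : (forall a, `|y0 a| <= K) ->
  0 < h -> n%:R * h = 1 -> forall k, (k <= n)%N ->
  forall a u, ball c rho u ->
  [/\ differentiable (euler y0 h k a) u,
      `|euler y0 h k a u| <= K * (1 + k%:R * h)
    & forall i, `|pd i (euler y0 h k a) u - k%:R * h *
        \sum_b A i a b (ray_point (k%:R * h) u) * euler y0 h k b u|
      <= k%:R * h ^+ 2 * (2 * euler_const K)].
Proof.
move=> y0K h0 nh; elim=> [_ a u cu|k IH kn a u cu].
  split=> [||i]; first exact: differentiable_cst.
    by rewrite mulr0n mul0r addr0 mulr1 /=; exact: y0K.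
  by rewrite mulr0n !mul0r subr0 [pd _ _ _]pd_cst normr0.
have {}IH := IH (ltnW kn).
have kh0 (m : nat) : 0 <= m%:R * h by rewrite mulr_ge0// ltW.
have kh1 (m : nat) : (m <= n)%N -> m%:R * h <= 1.
  by move=> mn; rewrite -[leRHS]nh ler_wpM2r ?ler_nat// ltW.
have p01 : 0 <= k%:R * h <= 1 by rewrite kh0 kh1 // ltnW.
have p'01 : 0 <= k.+1%:R * h <= 1 by rewrite kh0 kh1.
have K0 : 0 <= K by apply: le_trans (normr_ge0 _) (y0K a).
have dy b v : ball c rho v -> differentiable (euler y0 h k b) v by move=> /(IH b)[].
have [dy' pdy'] := pd_euler p01 dy a cu.
have cx := ball_ray_point p01 cu; have cx' := ball_ray_point p'01 cu.
have k1E : k.+1%:R * h = k%:R * h + h by rewrite -natr1 mulrDl mul1r.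
have yY b : `|euler y0 h k b u| <= K + K.
  have [_ + _] := IH b u cu; move=> /le_trans; apply.
  by move: p01 => /andP[_ /(ler_wpM2l K0)]; move: (k%:R * h) => p; lra.
split=> //.
  have nS : `|\sum_(q : 'I_N * J) (u - c) 0 q.1
      * A q.1 a q.2 (ray_point (k%:R * h) u) * euler y0 h k q.2 u| <= K.
    apply: le_trans (norm_sum_le (B := rho * M * (K + K)) _) _ => [q|].
      apply: normM_le => //; apply: normM_le; first exact: ball_coord.
      exact: AM.
    move: small => /(ler_wpM2r K0).
    by move: (#|_|%:R) => m; lra.
  have [_ yk _] := IH a u cu; rewrite k1E.
  have key (x p q : R) : x <= h * K -> q <= K * (1 + p) -> q + x <= K * (1 + (p + h)).
    by lra.
  rewrite /= (le_trans (ler_normD _ _))//; apply: key => //.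
  by rewrite normrM (ger0_norm (ltW h0)) ler_wpM2l// ltW.
move=> i; rewrite pdy' k1E /=.
pose T j := (u - c) 0 j.
have := @euler_defect_le R 'I_N J h (k%:R * h) rho M (K + K)
  (k%:R * h ^+ 2 * (2 * euler_const K)) euler_taylor T
  (fun j b b' => A j b b' (ray_point (k%:R * h) u))
  (fun j b b' => pd i (A j b b') (ray_point (k%:R * h) u))
  (fun b b' => A i b b' (ray_point (k%:R * h) u))
  (fun b b' => A i b b' (ray_point (k.+1%:R * h) u))
  (fun j b b' => pd j (A i b b') (ray_point (k%:R * h) u))
  (fun b => euler y0 h k b u) (fun b => pd i (euler y0 h k b) u) a.
rewrite /= -k1E => H.
have {}H := H (fun j b => flatA i j a b cx) small.
have h01 : 0 <= h <= 1 
  by rewrite ltW //=; have := kh1 1%N (leq_ltn_trans (leq0n _) kn); rewrite mul1r.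
have {}H := H h01 p'01 (fun j => ball_coord j cu) (fun j b b' => AM j b b' cx)
  (fun b b' => AM i b b' cx) (fun j b b' => dAM i b b' j cx).
have tay b : `|A i a b (ray_point (k.+1%:R * h) u) - A i a b (ray_point (k%:R * h) u)
    - h * \sum_j T j * pd j (A i a b) (ray_point (k%:R * h) u)| <= h ^+ 2 * euler_taylor.
  have xx j : (ray_point (k.+1%:R * h) u - ray_point (k%:R * h) u) 0 j = h * T j.
    by rewrite /ray_point /T k1E !mxE; ring.
  have := @taylor1 R N (A i a b) c rho M (h * rho) _ _ (dA i a b) (ddA i a b)
    (fun j k => ddAM i a b j k) cx cx'.
  have -> : h ^+ 2 * euler_taylor = N%:R * (h * rho * (N%:R * (h * rho * M))).
    by rewrite /euler_taylor; ring.
  rewrite mulr_sumr; under eq_bigr do rewrite xx -mulrA.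
  apply; last by rewrite mulr_ge0 ?ltW.
  move=> j; rewrite xx normrM (ger0_norm (ltW h0)) ler_wpM2l//; first exact: ltW.
  exact: ball_coord.
have {}H := H tay yY (fun b => (let: And3 _ _ d := IH b u cu in d) i).
apply: le_trans H _.
rewrite -/(euler_const K) -[k.+1%:R]natr1.
move: (kh1 _ (ltnW kn)).
have E0 : 0 <= euler_const K.
  rewrite /euler_const /euler_taylor.
  have M0 : 0 <= M by apply: le_trans (normr_ge0 _) (AM i a a cx).
  have r0 := ltW rho0.
  by rewrite !addr_ge0// ?mulrn_wge0// !mulr_ge0// ?addr_ge0.
move: E0; move: (euler_const K) (k%:R : R) => E m E0 m1.
have : (m * h) * (h ^+ 2 * E) <= h ^+ 2 * E.
  by rewrite ler_piMl// mulr_ge0// exprn_ge0// ltW.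
by nra.
Qed.

(** After [n = 1 / h] steps the node is [u] itself and the defect bound is [h] times a constant. The
    bound on the values is kept because [linear_estimate] needs one to start from. *)
Lemma approximate_solution y0 e : 0 < e -> exists y : J -> vec -> R,
  (forall a, y a c = y0 a) /\ exists K, forall a u, ball c rho u ->
  [/\ differentiable (y a) u, `|y a u| <= K
    & forall i, `|pd i (y a) u - \sum_b A i a b u * y b u| <= e].
Proof.
move=> e0; pose K := \sum_a `|y0 a|.
have y0K a : `|y0 a| <= K by rewrite /K (bigD1 a)//= lerDl sumr_ge0.
pose E := 2 * euler_const K; pose n := (Num.bound (`|E| / e)).+1.
have n0 : 0 < n%:R :> R by rewrite ltr0n.
pose h : R := n%:R^-1; have h0 : 0 < h by rewrite invr_gt0.
have nh : n%:R * h = 1 by rewrite divff// lt0r_neq0.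
have hE : h * E <= e.
  apply: le_trans (ler_norm _) _; rewrite normrM gtr0_norm// ler_pdivrMl//.
  rewrite -ler_pdivrMr//.
  have /archi_boundP/ltW/le_trans : 0 <= `|E| / e by rewrite divr_ge0// ltW.
  by apply; rewrite ler_nat.
exists (euler y0 h n); split; first by move=> a; exact: euler_center.
exists (K * (1 + 1)) => a u cu.
have [dy yK yd] := euler_invariant y0K h0 nh (leqnn n) a cu.
move: yK yd; rewrite nh => yK yd; split=> // i.
have := yd i; rewrite /ray_point mul1r scale1r subrr add0r scale1r.
by move=> /le_trans; apply; rewrite expr2 mulrA nh mul1r.
Qed.

End EulerScheme.

(** The limit is the supremum of the lower ends [x n - e n], all of which lie below every upper end
    [x m + e m]. *)
Lemma real_squeeze (R : realType) (x e : nat -> R) :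
  (forall n m, `|x n - x m| <= e n + e m) -> exists l, forall n, `|x n - l| <= e n.
Proof.
move=> xe; pose S := [set x n - e n | n in [set: nat]].
have S0 : S !=set0 by exists (x 0%N - e 0%N); exists 0%N.
have Sub m : ubound S (x m + e m).
  by move=> _ [n _ <-]; have := xe n m; rewrite ler_norml => /andP[_]; lra.
exists (sup S) => n; rewrite ler_norml; apply/andP; split.
  by have := ge_sup S0 (Sub n); lra.
have : x n - e n <= sup S by apply: ub_le_sup; [exists (x n + e n)|exists n].
lra.
Qed.

(** * Local solvability of flat systems *)

Section FlatSystems.
Variables (R : realType) (N : nat) (J : finType).
Local Notation vec := 'rV[R]_N.

Lemma continuous_fsum (I : Type) (r : seq I) (F : I -> vec -> R) (v : vec) :
  (forall i, {for v, continuous (F i)}) ->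
  {for v, continuous (fun u => \sum_(i <- r) F i u)}.
Proof.
move=> cF; elim: r => [|i r IH].
  have -> : (fun u => \sum_(i <- [::]) F i u) = (fun=> 0).
    by apply/funext => u; rewrite big_nil.
  exact: cst_continuous.
have -> : (fun u => \sum_(j <- i :: r) F j u) = F i + (fun u => \sum_(j <- r) F j u).
  by apply/funext => u; rewrite big_cons.
exact: continuousD.
Qed.

Lemma flat_system_on_ball (A : 'I_N -> J -> J -> vec -> R) (c : vec) (rho M : R) :
  (forall i a b, smooth (ball c rho) (A i a b)) ->
  (forall i a b u, ball c rho u -> `|A i a b u| <= M) ->
  (forall i a b j u, ball c rho u -> `|pd j (A i a b) u| <= M) ->
  (forall i a b j k u, ball c rho u -> `|pd k (pd j (A i a b)) u| <= M) ->
  flat_connection (ball c rho) A -> 0 < rho ->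
  (#|{: 'I_N * J}|)%:R * (rho * M) <= 2^-1 ->
  forall y0 : J -> R, exists2 y : J -> vec -> R, forall a, y a c = y0 a &
    total_linear (ball c rho) A y.
Proof.
move=> sA AM dAM ddAM flatA rho0 small y0.
have dA i a b u (cu : ball c rho u) := smooth_differentiable (sA i a b) cu.
have ddA i a b j u (cu : ball c rho u) :=
  smooth_differentiable (smooth_pd j (sA i a b)) cu.
have ap (n : nat) : exists y : J -> vec -> R, (forall a, y a c = y0 a) /\
   exists K, forall a u, ball c rho u ->
  [/\ differentiable (y a) u, `|y a u| <= K
    & forall i, `|pd i (y a) u - \sum_b A i a b u * y b u| <= n.+1%:R^-1].
  by apply: (approximate_solution dA ddA AM dAM ddAM flatA rho0 small);
    rewrite invr_gt0.
have normB4 (p q s t e1 e2 : R) : `|p - s| <= e1 -> `|q - t| <= e2 ->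
    `|p - q - (s - t)| <= e1 + e2.
  by rewrite !ler_norml => /andP[? ?] /andP[? ?]; apply/andP; split; lra.
have [Y YP] := choice ap.
(* The bound of [linear_estimate] for an error [1 / (n + 1)] in the equation; it is additive in that
   error, so two approximants differ by at most [e n + e m]. *)
pose e n : R := (N%:R * (rho * n.+1%:R^-1)) *+ 2.
have Ycauchy a u : ball c rho u -> forall n m, `|Y n a u - Y m a u| <= e n + e m.
  move=> cu n m; have [Yn [Kn nP]] := YP n; have [Ym [Km mP]] := YP m.
  have := @linear_estimate R N J A (fun a u => Y n a u - Y m a u) c rho M
    (n.+1%:R^-1 + m.+1%:R^-1) (Kn + Km) small rho0 _ AM _ _ _ _ a u cu.
  rewrite /e -mulrnDl -mulrDr -mulrDr; apply.
  - by rewrite addr_ge0// invr_ge0.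
  - move=> b v cv; apply: differentiableB; first by have [] := nP b v cv.
    by have [] := mP b v cv.
  - by move=> b; rewrite Yn Ym subrr.
  - move=> b v cv; rewrite (le_trans (ler_normB _ _))// lerD//.
      by have [] := nP b v cv.
    by have [] := mP b v cv.
  - move=> i b v cv; have [dn _ /(_ i) pn] := nP b v cv.
    have [dm _ /(_ i) pm] := mP b v cv; rewrite pdB //.
    under eq_bigr do rewrite mulrBr.
    by rewrite sumrB; exact: normB4.
(* Outside the ball the default value 0 is taken, so that [choice] yields a function on the whole
   space. *)
have lims a u : exists l, ball c rho u -> forall n, `|Y n a u - l| <= e n.
  have [cu|ncu] := pselect (ball c rho u); last by exists 0.
  by have [l lP] := real_squeeze (Ycauchy a u cu); exists l.
have [y yP] := choice (fun q : J * vec => lims q.1 q.2).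
(* One [n] for three errors: of the values, of [A_i y], where the former is multiplied by at most
   [B], and of the equation. *)
have small_e eps B : 0 < eps -> 0 <= B -> exists n,
    [/\ e n <= eps, B * e n <= eps & n.+1%:R^-1 <= eps].
  move=> eps0 B0; pose C : R := N%:R * rho *+ 2.
  have C0 : 0 <= C by rewrite mulrn_wge0// mulr_ge0// ltW.
  pose T := (C + B * C + 1) / eps.
  have BC0 : 0 <= B * C by rewrite mulr_ge0.
  have T0 : 0 <= T by apply: divr_ge0 (ltW eps0); rewrite addr_ge0// addr_ge0.
  exists (Num.bound T); set m := (Num.bound T).+1%:R : R.
  have Tm : T <= m by rewrite (le_trans (ltW (archi_boundP T0)))// ler_nat.
  have m0 : 0 < m by rewrite ltr0n.
  have eE : e (Num.bound T) = C / m by rewrite /e /C mulrA -mulrnAl.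
  have : C + B * C + 1 <= eps * m by rewrite [leRHS]mulrC -ler_pdivrMr.
  move=> CBm; split; first by rewrite eE ler_pdivrMr//; lra.
    by rewrite eE mulrA ler_pdivrMr//; lra.
  by rewrite -/m -[m^-1]mul1r ler_pdivrMr//; lra.
exists (fun a u => y (a, u)).
  move=> a; apply/eqP; rewrite -subr_eq0 -normr_le0.
  apply/ler_addgt0Pr => eps eps0; rewrite add0r distrC.
  have [n nP] := small_e _ _ eps0 (ler01 : 0 <= 1).
  have := yP (a, c) (ballxx c rho0) n; rewrite (YP n).1 => /le_trans; apply.
  by have [] := nP.
have cy a u : ball c rho u -> {for u, continuous (fun v => y (a, v))}.
  move=> cu; apply/(@cvgrPdist_le R R vec (nbhs u)) => eps eps0.
  have eps3 : 0 < eps / 3 by rewrite divr_gt0.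
  have [n [ne _ _]] := small_e _ _ eps3 (ler01 : 0 <= 1).
  have [_ [Kn nP]] := YP n.
  have cY : {for u, continuous (Y n a)}.
    by apply: differentiable_continuous; have [] := nP a u cu.
  have nb : nbhs u (ball c rho).
    by apply: open_nbhs_nbhs; split=> //; exact: ball_open.
  have : nbhs u (ball c rho `&` [set v | `|Y n a u - Y n a v| <= eps / 3]).
    by apply: filterI nb _; move: cY => /cvgrPdist_le; apply.
  apply: filterS => v [cv Yv].
  have key (p q r s : R) : `|r - p| <= e n -> `|s - q| <= e n -> e n <= eps / 3 ->
      `|r - s| <= eps / 3 -> `|p - q| <= eps.
    rewrite !ler_norml => /andP[? ?] /andP[? ?] ? /andP[? ?].
    by apply/andP; split; lra.
  exact: key (yP (a, u) cu n) (yP (a, v) cv n) ne Yv.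
have cA i a b u : ball c rho u -> {for u, continuous (A i a b)}.
  by move=> cu; apply: differentiable_continuous; exact: dA.
move=> a u cu.
have cg (i : 'I_N) v : ball c rho v ->
    {for v, continuous (fun v => \sum_b A i a b v * y (b, v))}.
  move=> cv; apply: continuous_fsum => b.
  by apply: continuousM; [exact: cA|exact: cy].
apply: (uniform_limit_differentiable cg) cu => eps eps0.
pose B : R := #|J|%:R * M.
have B0 : 0 <= Num.max B 1 by rewrite le_max ler01 orbT.
have eps2 : 0 < eps / 2 by rewrite divr_gt0.
have [n [ne Be ie]] := small_e _ _ eps2 B0.
have [_ [Kn nP]] := YP n.
exists (Y n a) => v cv; have [dv _ pv] := nP a v cv; split=> // [|i].
  by have := yP (a, v) cv n; move=> /le_trans; apply; move: ne eps0; lra.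
have key (p q s i0 b : R) : `|p - q| <= i0 -> `|q - s| <= b ->
    i0 <= eps / 2 -> b <= eps / 2 -> `|p - s| <= eps.
  rewrite !ler_norml => /andP[? ?] /andP[? ?] ? ?.
  by apply/andP; split; lra.
apply: key (pv i) _ ie Be; rewrite -sumrB.
apply: le_trans (norm_sum_le (B := M * e n) _) _ => [b|].
  rewrite -mulrBr; apply: normM_le; first exact: AM.
  exact: yP (b, v) cv n.
rewrite mulrA ler_wpM2r ?le_max ?lexx//.
by rewrite mulrn_wge0// mulr_ge0// mulr_ge0 ?invr_ge0// ltW.
Qed.

(* The radius depends on the connection only: it is shared by all initial
   values. *)
Theorem flat_system_solvable (D : set vec) (A : 'I_N -> J -> J -> vec -> R) (c : vec) :
  open D -> D c -> (forall i a b, smooth D (A i a b)) -> flat_connection D A ->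
  exists2 rho : R, 0 < rho & ball c rho `<=` D /\
  forall y0 : J -> R, exists y : J -> vec -> R,
    [/\ forall a, y a c = y0 a, total_linear (ball c rho) A y
      & forall a, smooth (ball c rho) (y a)].
Proof.
move=> oD Dc sA flatA.
have cont (f : vec -> R) : smooth D f -> {for c, continuous f}.
  by move=> sf; apply: differentiable_continuous; exact: smooth_differentiable sf Dc.
have [M0 M00 b0] := near_bounded (fun q : 'I_N * J * J => cont _ (sA q.1.1 q.1.2 q.2)).
have [M1 M10 b1] := near_bounded (fun q : 'I_N * J * J * 'I_N =>
  cont _ (smooth_pd q.2 (sA q.1.1.1 q.1.1.2 q.1.2))).
have [M2 M20 b2] := near_bounded (fun q : 'I_N * J * J * 'I_N * 'I_N =>
  cont _ (smooth_pd q.2 (smooth_pd q.1.2 (sA q.1.1.1.1 q.1.1.1.2 q.1.1.2)))).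
have nD : nbhs c D by exact: open_nbhs_nbhs.
pose M := Num.max M0 (Num.max M1 M2).
have Mgt0 : 0 < M by rewrite lt_max M00.
have [rho /andP[rho0 _] [sub small]] :=
  small_radius J (filterI nD (filterI b0 (filterI b1 b2))) Mgt0.
exists rho => //; split; first by move=> u /sub[].
have subD : ball c rho `<=` D by move=> u /sub[].
have sAb i a b : smooth (ball c rho) (A i a b) by exact: smooth_sub subD (sA i a b).
move=> y0.
have [y yc yA] : exists2 y : J -> vec -> R, forall a, y a c = y0 a &
    total_linear (ball c rho) A y.
  apply: (@flat_system_on_ball A c rho M sAb) => //.
  - move=> i a b u /sub[_ [/(_ (i, a, b))/= Ab _]].
    by rewrite le_max Ab.
  - move=> i a b j u /sub[_ [_ [/(_ (i, a, b, j))/= Ab _]]].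
    by rewrite !le_max Ab orbT.
  - move=> i a b j k u /sub[_ [_ [_ /(_ (i, a, b, j, k))/= Ab]]].
    by rewrite !le_max Ab !orbT.
  - by move=> i j a b u /subD; exact: flatA.
exists y; split=> // a.
(* Closed under differentiation up to polynomials: the system expresses the derivatives of the [y b]
   through the [y d] and the smooth coefficients. *)
pose B : set (vec -> R) := [set f | (exists b, f = y b) \/ smooth (ball c rho) f].
apply: (@smooth_poly_span R N (ball c rho) B); first exact: ball_open.
  move=> f [[b ->]|sf]; last first.
    split=> [u cu|i]; first exact: smooth_differentiable sf cu.
    by exists (pd i f) => //; apply: poly_span_base; right; exact: smooth_pd.
  split=> [u cu|i]; first by have [] := yA b u cu.
  exists (fun u => \sum_d A i b d u * y d u).
    apply: poly_span_sum => [|d]; first by right; exact: smooth_cst.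
    by apply: poly_spanM; apply: poly_span_base; [right|left; exists d].
  by move=> u cu; have [_ ->] := yA b u cu.
by apply: poly_span_base; left; exists a.
Qed.

End FlatSystems.

(** * Associativity of the algebra defined by a cubic form, pointwise *)

Section CubicForms.
Variables (R : realType) (N : nat) (eta : 'M[R]_N).
Hypothesis eta_nondeg : nondeg_sym eta.
Variable T : 'I_N -> 'I_N -> 'I_N -> R.
Implicit Types i j k l m n p q : 'I_N.
Local Notation B := (fun i j l => \sum_k invmx eta k l * T i j k).

Lemma lower_raised i j n : \sum_l B i j l * eta l n = T i j n.
Proof.
have [_ etaU] := eta_nondeg.
transitivity (\sum_k (invmx eta *m eta) k n * T i j k).
  under [RHS]eq_bigr do rewrite mxE mulr_suml.
  under [LHS]eq_bigr do rewrite mulr_suml.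
  rewrite exchange_big; apply: eq_bigr => k _; apply: eq_bigr => l _.
  by rewrite mulrAC.
rewrite mulVmx // (bigD1 n) //= big1 => [|k kn]; rewrite mxE ?eqxx ?mul1r ?addr0 //.
by rewrite (negbTE kn) mul0r.
Qed.

Hypothesis T12 : forall i j k, T i j k = T j i k.

(** [B i j l] are the structure constants. The second form says that multiplications by basis
    vectors commute; the first is the same condition with the free upper index lowered by [eta],
    which loses nothing as [eta] is invertible. *)
Lemma cubic_associativity :
  (forall i j m n, \sum_k \sum_l T i j k * invmx eta k l * T l m n =
                   \sum_k \sum_l T i m k * invmx eta k l * T l j n) <->
  (forall i j m q, \sum_p (B j m p * B i p q - B i m p * B j p q) = 0).
Proof.
have E i j m n : \sum_k \sum_l T i j k * invmx eta k l * T l m n =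
    \sum_l B i j l * T l m n.
  rewrite exchange_big; apply: eq_bigr => l _; rewrite mulr_suml.
  by apply: eq_bigr => k _; rewrite [invmx _ _ _ * _]mulrC.
have BC i j l : B i j l = B j i l by apply: eq_bigr => k _; rewrite T12.
have raise i j m n : \sum_p B i j p * T m p n = \sum_p B j i p * T p m n.
  by apply: eq_bigr => p _; rewrite [B i j p]BC T12.
have E1 i j m q : \sum_p B j m p * B i p q =
    \sum_k invmx eta k q * (\sum_p B m j p * T p i k).
  under [RHS]eq_bigr do rewrite -raise mulr_sumr.
  rewrite exchange_big; apply: eq_bigr => p _; rewrite mulr_sumr.
  by apply: eq_bigr => k _; rewrite mulrCA.
have E2 i j m n : \sum_l B i j l * T l m n =
    \sum_q (\sum_p B j i p * B m p q) * eta q n.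
  rewrite -raise; under eq_bigr do rewrite -lower_raised mulr_sumr.
  rewrite exchange_big; apply: eq_bigr => q _; rewrite mulr_suml.
  by apply: eq_bigr => p _; rewrite mulrA.
split=> H i j m n.
- rewrite sumrB; apply/eqP; rewrite subr_eq0; apply/eqP; rewrite E1 E1.
  by apply: eq_bigr => k _; congr (_ * _); rewrite -!E H.
- rewrite E E E2 E2; apply: eq_bigr => q _; congr (_ * _).
  by apply/eqP; rewrite -subr_eq0 -sumrB H.
Qed.

End CubicForms.

(** * Structure functions of the multiplication and their symmetries *)

Section AssociativitySystem.
Variables (R : realType) (N : nat).
Local Notation vec := 'rV[R]_N.

Lemma pd_total_linear (J : finType) (D : set vec) (A : 'I_N -> J -> J -> vec -> R)
    (y : J -> vec -> R) i j a u : open D ->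
  (forall i a b, smooth D (A i a b)) -> total_linear D A y -> D u ->
  pd i (pd j (y a)) u =
  \sum_b (pd i (A j a b) u + \sum_c A j a c u * A i c b u) * y b u.
Proof.
move=> oD sA yA Du.
have -> : pd i (pd j (y a)) u = pd i (fun v => \sum_b A j a b v * y b v) u.
  by apply: (pd_eq i oD _ Du) => v Dv; have [_ ->] := yA a v Dv.
rewrite pd_sumM => [|b|b]; last first.
- by have [] := yA b u Du.
- exact: smooth_differentiable (sA _ _ _) Du.
under [RHS]eq_bigr do rewrite mulrDl.
rewrite !big_split /= addrC; congr (_ + _).
under eq_bigr => b _ do rewrite (yA b u Du).2 mulr_sumr.
under [RHS]eq_bigr do rewrite mulr_suml.
by rewrite exchange_big; do 2![apply: eq_bigr => ? _]; rewrite mulrA.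
Qed.

Variables (D : set vec) (eta : 'M[R]_N) (Phi : vec -> R).
Hypothesis oD : open D.
Hypothesis eta_nondeg : nondeg_sym eta.
Hypothesis sPhi : smooth D Phi.
Implicit Types (i j k l m p q : 'I_N) (u : vec) (c : R).

Lemma D3_smooth i j k : smooth D (D3 Phi i j k).
Proof. by do 3!apply: smooth_pd. Qed.

Lemma D3C12 i j k u : D u -> D3 Phi i j k u = D3 Phi j i k u.
Proof. by move=> Du; apply: pd_comm oD _ Du; exact: smooth_pd. Qed.

Lemma D3C23 i j k u : D u -> D3 Phi i j k u = D3 Phi i k j u.
Proof. by move=> Du; apply: pd_eq oD _ u Du => v Dv; exact: pd_comm oD sPhi Dv. Qed.

Lemma D4C12 i j k l u : D u -> pd i (D3 Phi j k l) u = pd j (D3 Phi i k l) u.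
Proof. by move=> Du; apply: pd_comm oD _ Du; do 2!apply: smooth_pd. Qed.

Definition struct_coef i j l u := \sum_k invmx eta k l * D3 Phi i j k u.
Local Notation B := struct_coef.

Lemma struct_coefC i j l u : D u -> B i j l u = B j i l u.
Proof. by move=> Du; apply: eq_bigr => k _; rewrite D3C12. Qed.

Lemma struct_coef_smooth i j l : smooth D (B i j l).
Proof.
apply: smooth_sum => // k; apply: smoothM => //; first exact: smooth_cst.
exact: D3_smooth.
Qed.

Lemma pd_struct_coef m i j l u : D u ->
  pd m (B i j l) u = \sum_k invmx eta k l * pd m (D3 Phi i j k) u.
Proof.
move=> Du; rewrite pd_sumM => [|k|k]; last first.
- exact: smooth_differentiable (D3_smooth _ _ _) Du.
- exact: differentiable_cst.
by apply: eq_bigr => k _; rewrite pd_cst mul0r addr0.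
Qed.

(** Symmetry of the fourth derivatives of [Phi]. It removes the derivative terms from the curvature,
    so that only the associator is left. *)
Lemma pd_struct_coefC m i j l u : D u -> pd m (B i j l) u = pd i (B m j l) u.
Proof.
move=> Du; rewrite (pd_struct_coef m i j l Du) (pd_struct_coef i m j l Du).
by apply: eq_bigr => k _; rewrite (D4C12 m i j k Du).
Qed.

Lemma associativity_commutator : associativity D eta Phi <->
  forall u, D u -> forall i j m q,
    \sum_p (B j m p u * B i p q u - B i m p u * B j p q u) = 0.
Proof.
have sym u (Du : D u) i j k : D3 Phi i j k u = D3 Phi j i k u := D3C12 i j k Du.
split=> H u Du.
  exact ((cubic_associativity eta_nondeg (sym u Du)).1 (H u Du)).
exact ((cubic_associativity eta_nondeg (sym u Du)).2 (H u Du)).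
Qed.

Lemma struct_coef_lower i j n u : \sum_l B i j l u * eta l n = D3 Phi i j n u.
Proof. exact: (lower_raised eta_nondeg (fun i j k => D3 Phi i j k u)). Qed.

End AssociativitySystem.

Local Opaque struct_coef pd D3.

(** * The first-order system for the 1-jets of [r] and [n], and its curvature *)

Section JetSystem.
Variables (R : realType) (N : nat).
Local Notation vec := 'rV[R]_N.
Local Notation amb := 'rV[R]_(N + N).
Local Notation idx := (bool * option 'I_N)%type.

Lemma sum_idx (F : idx -> R) :
  \sum_b F b = (F (true, None) + \sum_l F (true, Some l))
    + (F (false, None) + \sum_l F (false, Some l)).
Proof.
have opt (G : option 'I_N -> R) : \sum_o G o = G None + \sum_l G (Some l).
  rewrite (bigD1 None) //=; congr (_ + _).
  rewrite (reindex_omap Some id) => [|[]//].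
  by apply: eq_bigl => l; rewrite /= eqxx.
transitivity (\sum_s \sum_o F (s, o)).
  by rewrite pair_bigA; apply: eq_bigr => -[].
by rewrite big_bool !opt.
Qed.

(** The constants on the right-hand sides of the equations for [r] and for [n]; their product [- c]
    is the factor in front of the curvature. *)
Definition coef_sign (c : R) (s : bool) : R := if s then c else -1.

(* The index (true, None) stands for r, (true, Some i) for d r / d u^i, and
   (false, _) likewise for n. *)
Definition jet_coef (eta : 'M[R]_N) (Phi : vec -> R) (c : R)
    (i : 'I_N) (a b : idx) (u : vec) : R :=
  if a.2 is Some j then
    if b.2 is Some l then
      if b.1 == ~~ a.1 then coef_sign c a.1 * struct_coef eta Phi i j l u else 0
    else 0
  else (b == (a.1, Some i))%:R.

Definition jet (r n : vec -> amb) (k : 'I_(N + N)) (a : idx) (u : vec) : R :=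
  let f := if a.1 then r else n in
  (if a.2 is Some i then pd i f u else f u) 0 k.

Variables (D : set vec) (eta : 'M[R]_N) (Phi : vec -> R).
Hypothesis oD : open D.
Hypothesis eta_nondeg : nondeg_sym eta.
Hypothesis sPhi : smooth D Phi.
Implicit Types (i j k l m p q : 'I_N) (u : vec) (c : R) (s : bool).
Local Notation B := (struct_coef eta Phi).
Local Notation A := (jet_coef eta Phi).

Lemma sum_jet_coef_None c i s u (y : idx -> R) :
  \sum_b A c i (s, None) b u * y b = y (s, Some i).
Proof.
rewrite (bigD1 (s, Some i)) //= /jet_coef /= eqxx mul1r big1 ?addr0 // => b bN.
by rewrite (negbTE bN) mul0r.
Qed.

Lemma sum_jet_coef_Some c i s j u (y : idx -> R) :
  \sum_b A c i (s, Some j) b u * y b =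
  coef_sign c s * \sum_l B i j l u * y (~~ s, Some l).
Proof.
rewrite sum_idx /jet_coef /= !mul0r !add0r mulr_sumr.
case: s => /=.
  rewrite [X in X + _]big1 ?add0r => [|l _]; last by rewrite mul0r.
  by apply: eq_bigr => l _; rewrite mulrA.
rewrite [X in _ + X]big1 ?addr0 => [|l _]; last by rewrite mul0r.
by apply: eq_bigr => l _; rewrite mulrA.
Qed.

Lemma jet_coef_smooth c i a b : smooth D (A c i a b).
Proof.
case: a b => [s [j|]] [s' [l|]]; rewrite /jet_coef /=; try exact: smooth_cst.
case: eqP => _; last exact: smooth_cst.
apply: smoothM => //; first exact: smooth_cst.
exact: struct_coef_smooth.
Qed.

(** On first derivatives the connection exchanges [r] and [n]. Hence its products preserve the
    boolean and give the commutator, while its derivatives exchange it and cancel by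
    [pd_struct_coefC]. The rows of [r] and [n] themselves vanish by symmetry of [B] in its first two
    indices. *)
Lemma jet_coef_flatness c i j a b u : D u ->
  pd i (A c j a b) u - pd j (A c i a b) u
  + \sum_d (A c j a d u * A c i d b u - A c i a d u * A c j d b u) =
  if a.2 is Some m then if b.2 is Some q then if b.1 == a.1 then
    - c * \sum_p (B j m p u * B i p q u - B i m p u * B j p q u)
  else 0 else 0 else 0.
Proof.
move=> Du; rewrite sumrB.
have BC k l m : B k l m u = B l k m u
  := struct_coefC eta oD sPhi k l m Du.
case: a b => [s [m|]] [s' b]; last first.
  rewrite !sum_jet_coef_None !(pd_cst _ _) subrr add0r /=.
  by apply/eqP; rewrite subr_eq0; case: b => [l|]; rewrite /jet_coef /= ?(BC i j l).
rewrite !sum_jet_coef_Some; case: b => [q|]; last first.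
  rewrite !(pd_cst _ _) subrr add0r.
  rewrite [X in _ * X - _]big1 => [|l _]; last by rewrite /jet_coef mulr0.
  rewrite [X in _ - _ * X]big1 => [|l _]; last by rewrite /jet_coef mulr0.
  by rewrite mulr0 subrr.
have [->|ss'] := eqVneq s' s.
  have -> : A c j (s, Some m) (s, Some q) = fun=> 0.
    by apply/funext => v; rewrite /jet_coef /=; case: (s).
  have -> : A c i (s, Some m) (s, Some q) = fun=> 0.
    by apply/funext => v; rewrite /jet_coef /=; case: (s).
  rewrite !(pd_cst _ _) subrr add0r.
  have AE k l : A c k (~~ s, Some l) (s, Some q) u = coef_sign c (~~ s) * B k l q u.
    by rewrite /jet_coef /= negbK eqxx.
  have signs : coef_sign c s * coef_sign c (~~ s) = - c.
    by case: (s); rewrite /coef_sign /= ?mulrN1 // mulN1r.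
  have E k k' : coef_sign c s * \sum_l B k m l u * A c k' (~~ s, Some l) (s, Some q) u =
      - c * \sum_l B k m l u * B k' l q u.
    rewrite -signs -mulrA; congr (_ * _); rewrite mulr_sumr.
    by apply: eq_bigr => l _; rewrite AE mulrCA.
  transitivity (- c * (\sum_l B j m l u * B i l q u)
      - (- c * (\sum_l B i m l u * B j l q u))).
    by congr (_ - _); [exact: (E j i)|exact: (E i j)].
  by rewrite -mulrBr /= ?eqxx sumrB.
have s'E : s' = ~~ s by move: ss'; case: (s) (s') => -[].
have AE k : A c k (s, Some m) (s', Some q) =
    fun u => coef_sign c s *: B k m q u.
  by apply/funext => v; rewrite s'E /jet_coef /= eqxx.
have dB k l : differentiable (B k m q) u.
  exact: smooth_differentiable (struct_coef_smooth eta oD sPhi k m q) Du.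
rewrite (AE i) (AE j) (pdZ _ i (dB j m)) (pdZ _ j (dB i m)).
rewrite (pd_struct_coefC eta oD sPhi i j m q Du) subrr add0r.
rewrite [X in _ * X - _]big1 => [|l _]; last first.
  by rewrite s'E /jet_coef /= eqb_negLR negbK; case: (s); rewrite mulr0.
rewrite [X in _ - _ * X]big1 => [|l _]; last first.
  by rewrite s'E /jet_coef /= eqb_negLR negbK; case: (s); rewrite mulr0.
by rewrite mulr0 subrr.
Qed.

Lemma flat_jet_coef c : c != 0 ->
  flat_connection D (A c) <-> associativity D eta Phi.
Proof.
move=> c0; split.
  move=> flat; apply/(associativity_commutator oD eta_nondeg sPhi).
  move=> u Du i j m q; have := flat i j (true, Some m) (true, Some q) u Du.
  rewrite (jet_coef_flatness c i j _ _ Du) /= => /eqP.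
  by rewrite mulf_eq0 oppr_eq0 (negbTE c0) => /eqP.
move=> /(associativity_commutator oD eta_nondeg sPhi) H i j [s m] [s' q] u Du.
rewrite (jet_coef_flatness c i j _ _ Du).
by case: m q => [m|] [q|] //=; case: eqP => // _; rewrite (H u Du) mulr0.
Qed.

End JetSystem.

(** * Solutions of the second-order system versus flat sections of 1-jets *)

Section Consistency.
Variables (R : realType) (N : nat).
Local Notation vec := 'rV[R]_N.
Local Notation amb := 'rV[R]_(N + N).
Local Notation idx := (bool * option 'I_N)%type.

Lemma contract_row (M : nat) (e : 'M[R]_N) (T : 'I_N -> R) (v : 'I_N -> 'rV[R]_M)
    (c : R) q :
  (\sum_k \sum_l (c * e k l * T k) *: v l) 0 q =
  c * \sum_l (\sum_k e k l * T k) * v l 0 q.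
Proof.
rewrite exchange_big summxE mulr_sumr; apply: eq_bigr => l _.
rewrite summxE mulr_suml mulr_sumr; apply: eq_bigr => k _.
by rewrite mxE !mulrA.
Qed.

Lemma contract_row1 (M : nat) (e : 'M[R]_N) (T : 'I_N -> R) (v : 'I_N -> 'rV[R]_M) q :
  (\sum_k \sum_l (e k l * T k) *: v l) 0 q =
  \sum_l (\sum_k e k l * T k) * v l 0 q.
Proof.
rewrite -[RHS]mul1r -contract_row; congr (fun_of_matrix _ _ _).
by apply: eq_bigr => k _; apply: eq_bigr => l _; rewrite mul1r.
Qed.

Variables (D : set vec) (eta : 'M[R]_N) (Phi : vec -> R).
Hypothesis oD : open D.
Hypothesis eta_nondeg : nondeg_sym eta.
Hypothesis sPhi : smooth D Phi.
Implicit Types (i j l : 'I_N) (u : vec) (c : R) (s : bool).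
Local Notation B := (struct_coef eta Phi).
Local Notation A := (jet_coef eta Phi).

Lemma solvesE (W : set vec) c (r n : vec -> amb) :
  solves W eta Phi c r n <->
  [/\ smooth W r, smooth W n & forall u, W u -> forall s i j q,
    pd i (pd j (if s then r else n)) u 0 q =
    coef_sign c s * \sum_l B i j l u * pd l (if ~~ s then r else n) u 0 q].
Proof.
have E i j u (f : vec -> amb) q :
    (\sum_k \sum_l (c * invmx eta k l * D3 Phi i j k u) *: pd l f u) 0 q =
    c * \sum_l B i j l u * pd l f u 0 q.
  exact: (contract_row (invmx eta) (fun k => D3 Phi i j k u) (fun l => pd l f u)).
have E' i j u (f : vec -> amb) q :
    (- (\sum_k \sum_l (invmx eta k l * D3 Phi i j k u) *: pd l f u)) 0 q =
    -1 * \sum_l B i j l u * pd l f u 0 q.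
  rewrite mxE mulN1r; congr (- _).
  exact: (contract_row1 (invmx eta) (fun k => D3 Phi i j k u) (fun l => pd l f u)).
split=> -[sr sn H]; split=> // u Wu.
  by move=> s i j q; have [Hr Hn] := H u Wu i j; case: s => /=;
    [rewrite Hr; exact: E|rewrite Hn; exact: E'].
move=> i j; split; apply/rowP => q.
  by rewrite [LHS](H u Wu true i j q); exact/esym/E.
by rewrite [LHS](H u Wu false i j q); exact/esym/E'.
Qed.

Lemma jet_solution (W : set vec) c (r n : vec -> amb) : open W ->
  solves W eta Phi c r n -> forall k,
  total_linear W (A c) (jet r n k) /\ forall a, smooth W (jet r n k a).
Proof.
move=> oW /solvesE[sr sn H] k.
have sf s : smooth W (if s then r else n) by case: s.
have sj a : smooth W (jet r n k a).
  case: a => s [i|].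
    by apply: (smooth_rowP (pd i (if s then r else n)) oW).1; exact: smooth_pd (sf s).
  exact: (smooth_rowP (if s then r else n) oW).1 (sf s) k.
split=> // -[s [j|]] u Wu; split=> [|i]; first exact: smooth_differentiable (sj _) Wu.
- rewrite sum_jet_coef_Some; move: (H u Wu s i j k) => {H} /(etrans _); apply.
  exact: (pd_row i k (smooth_differentiable (smooth_pd j (sf s)) Wu)).
- exact: smooth_differentiable (sj _) Wu.
- rewrite sum_jet_coef_None.
  exact: (pd_row i k (smooth_differentiable (sf s) Wu)).
Qed.

Lemma solution_of_jets (W : set vec) c (y : 'I_(N + N) -> idx -> vec -> R) :
  open W -> (forall k, total_linear W (A c) (y k)) ->
  (forall k a, smooth W (y k a)) ->
  let f s u : amb := \row_k y k (s, None) u in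
  solves W eta Phi c (f true) (f false) /\
  forall u, W u -> forall k a, jet (f true) (f false) k a u = y k a u.
Proof.
move=> oW yA sy f.
have fE s : (if s then f true else f false) = f s by case: s.
have rowE s k : (fun u => f s u 0 k) = y k (s, None).
  by apply/funext => u; rewrite mxE.
have sf s : smooth W (f s).
  by apply/(smooth_rowP _ oW) => k; rewrite rowE; exact: sy.
have p1 s i u k : W u -> pd i (f s) u 0 k = y k (s, Some i) u.
  move=> Wu; rewrite -(pd_row i k (smooth_differentiable (sf s) Wu)) rowE.
  by rewrite (yA k (s, None) u Wu).2 sum_jet_coef_None.
have jE u : W u -> forall k a, jet (f true) (f false) k a u = y k a u.
  move=> Wu k [s [i|]]; rewrite /jet fE; first exact: p1.
  by rewrite mxE.
split=> //; apply/solvesE; split=> // u Wu s i j q.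
rewrite !fE -(pd_row i q (smooth_differentiable (smooth_pd j (sf s)) Wu)).
rewrite (pd_eq i oW (g := y q (s, Some j)) _ Wu) => [|v Wv]; last exact: p1.
rewrite (yA q (s, Some j) u Wu).2 sum_jet_coef_Some; congr (_ * _).
by apply: eq_bigr => l _; rewrite (p1 (~~ s) l u q Wu).
Qed.

(** The components of [r] and [n] in each ambient coordinate solve the same scalar system; since the
    radius does not depend on the initial values, all of them live on one ball. *)
Lemma associativity_local_solutions c : c != 0 -> associativity D eta Phi ->
  forall u0, D u0 -> exists2 rho : R, 0 < rho & ball u0 rho `<=` D /\
  forall (r0 n0 : amb) (r1 n1 : 'I_N -> amb), exists r n : vec -> amb,
    solves (ball u0 rho) eta Phi c r n /\
    [/\ r u0 = r0, n u0 = n0, forall i, pd i r u0 = r1 i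
      & forall i, pd i n u0 = n1 i].
Proof.
move=> c0 /(flat_jet_coef oD eta_nondeg sPhi c0) flat u0 Du0.
have [rho rho0 [sub ex]] :=
  flat_system_solvable oD Du0 (jet_coef_smooth eta oD sPhi c) flat.
exists rho => //; split=> // r0 n0 r1 n1.
pose y0 (k : 'I_(N + N)) (a : idx) : R :=
  (if a.2 is Some i then (if a.1 then r1 else n1) i else if a.1 then r0 else n0) 0 k.
have [y yP] := choice (fun k => ex (y0 k)).
have oW : open (ball u0 rho) by exact: ball_open.
have cW : ball u0 rho u0 by exact: ballxx.
have [||sol jE] := @solution_of_jets (ball u0 rho) c y oW.
- by move=> k; have [] := yP k.
- by move=> k a; have [_ _] := yP k; apply.
have init k a : jet (fun u => \row_k y k (true, None) u)
    (fun u => \row_k y k (false, None) u) k a u0 = y0 k a.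
  by rewrite (jE u0 cW k a); have [->] := yP k.
exists (fun u => \row_k y k (true, None) u), (fun u => \row_k y k (false, None) u).
split=> //; split=> [||i|i]; apply/rowP => k.
- exact: (init k (true, None)).
- exact: (init k (false, None)).
- exact: (init k (true, Some i)).
- exact: (init k (false, Some i)).
Qed.

(** When the initial jet is the [b]-th unit vector, the two mixed derivatives of component [a] at
    [u0] are the entries in row [a] and column [b] of the two matrices compared by flatness. *)
Lemma consistent_flat c : consistent D eta Phi c -> flat_connection D (A c).
Proof.
move=> cons i j a b u0 Du0.
(* Any ambient coordinate would do; [i] shows that there is one. *)
pose k0 : 'I_(N + N) := lshift N i.
pose e (b' : idx) : amb := (b' == b)%:R *: delta_mx 0 k0.
have [W [r [n [oW Wu0 WD sol [r0 n0 r1 n1]]]]] := cons u0 Du0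
  (e (true, None)) (e (false, None)) (fun i => e (true, Some i))
  (fun i => e (false, Some i)).
have [yA sy] := jet_solution oW sol k0.
have y0 b' : jet r n k0 b' u0 = (b' == b)%:R.
  have eE : e b' 0 k0 = (b' == b)%:R by rewrite /e !mxE !eqxx mulr1.
  rewrite -eE; case: b' {eE} => -[] [l|]; rewrite /jet /=.
  - by rewrite r1.
  - by rewrite r0.
  - by rewrite n1.
  - by rewrite n0.
have sA l a' b' : smooth W (A c l a' b').
  exact: smooth_sub WD (jet_coef_smooth eta oD sPhi c l a' b').
have pick (F : idx -> R) : \sum_b' F b' * jet r n k0 b' u0 = F b.
  rewrite (bigD1 b) //= y0 eqxx mulr1 big1 ?addr0 // => b' bN.
  by rewrite y0 (negbTE bN) mulr0.
have E1 := etrans (pd_total_linear i j a oW sA yA Wu0) (pick _).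
have E2 := etrans (pd_total_linear j i a oW sA yA Wu0) (pick _).
have C := pd_comm i j oW (sy a) Wu0.
rewrite sumrB; move: (etrans (esym E1) (etrans C E2)).
move: (pd i _ u0) (pd j _ u0) (\sum_d _) (\sum_d _) => p q s t H.
by apply/eqP; rewrite addrACA H -opprD subrr.
Qed.

Theorem consistent_associativity c : c != 0 ->
  consistent D eta Phi c <-> associativity D eta Phi.
Proof.
move=> c0; split=> [/consistent_flat|H u0 Du0 r0 n0 r1 n1].
  by move/(flat_jet_coef oD eta_nondeg sPhi c0).
have [rho rho0 [sub ex]] := associativity_local_solutions c0 H Du0.
have [r [n [sol init]]] := ex r0 n0 r1 n1.
exists (ball u0 rho), r, n; split=> //; first exact: ball_open.
exact: ballxx.
Qed.

End Consistency.

(** * Algebra and differentiation of the scalar product *)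

Section DotProduct.
Variables (R : realType) (M : nat) (G : 'M[R]_M).
Implicit Types x y z : 'rV[R]_M.

Lemma dotDl x y z : dot G (x + y) z = dot G x z + dot G y z.
Proof. by rewrite /dot !mulmxDl mxE. Qed.

Lemma dotDr x y z : dot G z (x + y) = dot G z x + dot G z y.
Proof. by rewrite /dot linearD /= mulmxDr mxE. Qed.

Lemma dotZl a x y : dot G (a *: x) y = a * dot G x y.
Proof. by rewrite /dot -!scalemxAl mxE. Qed.

Lemma dotZr a x y : dot G x (a *: y) = a * dot G x y.
Proof. by rewrite /dot linearZ /= -scalemxAr mxE. Qed.

Lemma dot_suml (I : Type) (s : seq I) (F : I -> 'rV[R]_M) y :
  dot G (\sum_(i <- s) F i) y = \sum_(i <- s) dot G (F i) y.
Proof. by rewrite /dot !mulmx_suml summxE. Qed.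

Lemma dot_sumr (I : Type) (s : seq I) (F : I -> 'rV[R]_M) x :
  dot G x (\sum_(i <- s) F i) = \sum_(i <- s) dot G x (F i).
Proof. by rewrite /dot linear_sum /= mulmx_sumr summxE. Qed.

Lemma dotC x y : G^T = G -> dot G x y = dot G y x.
Proof.
move=> GT; have -> : dot G x y = (x *m G *m y^T)^T 0 0 by rewrite mxE.
by rewrite !trmx_mul trmxK GT mulmxA.
Qed.

Lemma gram_mxE (K : nat) (F : 'M[R]_(K, M)) i j :
  (F *m G *m F^T) i j = dot G (row i F) (row j F).
Proof.
rewrite /dot !mxE; apply: eq_bigr => k _; rewrite !mxE; congr (_ * _).
by apply: eq_bigr => l _; rewrite !mxE.
Qed.

Lemma dotE x y : dot G x y = \sum_q (x *m G) 0 q * y 0 q.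
Proof. by rewrite /dot mxE; apply: eq_bigr => q _; rewrite [y^T _ _]mxE. Qed.

Variable N : nat.
Local Notation vec := 'rV[R]_N.

Lemma differentiable_dot (f g : vec -> 'rV[R]_M) u : differentiable f u ->
  differentiable g u -> differentiable (fun v => dot G (f v) (g v)) u.
Proof.
move=> /differentiable_rowP df /differentiable_rowP dg.
have -> : (fun v => dot G (f v) (g v)) =
    (fun v => \sum_q (\sum_p f v 0 p * G p q) * g v 0 q).
  by apply/funext => v; rewrite dotE; apply: eq_bigr => q _; rewrite mxE.
apply: differentiable_fsum => q; apply: differentiableM => //.
apply: differentiable_fsum => p.
by apply: (@differentiableM R vec (fun v => f v 0 p) (fun=> G p q)).
Qed.

Lemma pd_dot (f g : vec -> 'rV[R]_M) i u : differentiable f u ->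
  differentiable g u ->
  pd i (fun v => dot G (f v) (g v)) u = dot G (pd i f u) (g u) + dot G (f u) (pd i g u).
Proof.
move=> df dg; have dfk := (differentiable_rowP f u).1 df.
have dgk := (differentiable_rowP g u).1 dg.
have -> : (fun v => dot G (f v) (g v)) =
    (fun v => \sum_q (\sum_p f v 0 p * G p q) * g v 0 q).
  by apply/funext => v; rewrite dotE; apply: eq_bigr => q _; rewrite mxE.
have dcst p q : differentiable (fun _ : vec => G p q) u by exact: differentiable_cst.
have dF q : differentiable (fun v => \sum_p f v 0 p * G p q) u.
  apply: differentiable_fsum => p.
  exact: (@differentiableM R vec (fun v => f v 0 p) (fun=> G p q)).
rewrite pd_sumM // big_split /= addrC !dotE; congr (_ + _); apply: eq_bigr => q _.
  rewrite pd_sumM // mxE; congr (_ * _); apply: eq_bigr => p _.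
  by rewrite pd_cst mulr0 add0r pd_row.
by rewrite mxE pd_row.
Qed.

End DotProduct.

(** * Functions with zero gradient; connectedness of balls *)

Section ConstantFunctions.
Variables (R : realType) (N M : nat).
Local Notation vec := 'rV[R]_N.

Lemma pd_eq0_constant (W : set vec) (f : vec -> 'rV[R]_M) u0 : open W ->
  connected W -> (forall u, W u -> differentiable f u) ->
  (forall u, W u -> forall i, pd i f u = 0) -> W u0 ->
  forall u, W u -> f u = f u0.
Proof.
move=> oW cW df pf Wu0 u Wu; apply/rowP => k; apply/eqP; rewrite -subr_eq0; apply/eqP.
pose y (_ : unit) v := f v 0 k - f u0 0 k.
apply: (@total_linear_unique R N unit W (fun _ _ _ _ => 0) y u0 oW cW _ _ Wu0 _ u Wu tt).
- by move=> *; exact: cst_continuous.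
- move=> [] v Wv; have dk := (differentiable_rowP f v).1 (df v Wv) k.
  have dc : differentiable (fun _ : vec => f u0 0 k) v by exact: differentiable_cst.
  split=> [|i]; first exact: differentiableB.
  rewrite big1 => [|b _]; last by rewrite mul0r.
  by rewrite pdB // pd_cst subr0 pd_row ?pf ?mxE //; exact: df.
- by move=> []; rewrite /y subrr.
Qed.

Lemma connected_ball (c : vec) (rho : R) : 0 < rho -> connected (ball c rho).
Proof.
move=> rho0; have cc : ball c rho c by exact: ballxx.
pose seg (v : vec) := (fun t : R => c + t *: (v - c)) @` `[0, 1]%classic.
have -> : ball c rho = \bigcup_(v in ball c rho) seg v.
  apply/seteqP; split=> [v cv|_ [v cv [t t01 <-]]].
    exists v => //; exists 1; last by rewrite scale1r addrC subrK.
    by rewrite /= in_itv /= ler01 lexx.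
  by apply: ball_segment => //; rewrite addrC subrK.
apply: bigcup_connected.
  exists c => v cv; exists 0; last by rewrite scale0r addr0.
  by rewrite /= in_itv /= lexx ler01.
move=> v cv; apply: connected_continuous_connected; first exact: segment_connected.
apply: continuous_subspaceT => t; apply: cvgD; first exact: cvg_cst.
by apply: cvgZr_tmp; exact: cvg_id.
Qed.

End ConstantFunctions.

(** * Moving frames: uniqueness and conservation of the Gram matrix *)

Section StructureEquations.
Variables (R : realType) (N : nat).
Local Notation vec := 'rV[R]_N.
Local Notation amb := 'rV[R]_(N + N).
Local Notation fidx := (bool * 'I_N)%type.
Variables (D : set vec) (eta : 'M[R]_N) (Phi : vec -> R).
Hypothesis oD : open D.
Hypothesis eta_nondeg : nondeg_sym eta.
Hypothesis sPhi : smooth D Phi.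
Variable c : R.
Hypothesis c0 : c != 0.
Implicit Types (i j l m : 'I_N) (u : vec) (s : bool).
Implicit Types (fr : bool -> 'I_N -> vec -> amb).
Local Notation B := (struct_coef eta Phi).

(* fr true consists of the tangent vectors and fr false of the normals; these
   are the Gauss and Weingarten equations. *)
Definition structure_equations (W : set vec) fr := forall u, W u ->
  forall s i, differentiable (fr s i) u /\
  forall m, pd m (fr s i) u = \sum_l (coef_sign c s * B m i l u) *: fr (~~ s) l u.

Definition frame_coef m (a b : fidx) u : R :=
  if b.1 == ~~ a.1 then coef_sign c a.1 * B m a.2 b.2 u else 0.

Lemma frame_coef_continuous m a b u : D u -> {for u, continuous (frame_coef m a b)}.
Proof.
move=> Du; rewrite /frame_coef; case: eqP => _; last exact: cst_continuous.
have sB := struct_coef_smooth eta oD sPhi m a.2 b.2.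
apply: (@continuousM _ _ (fun=> coef_sign c a.1)); first exact: cst_continuous.
exact: differentiable_continuous (smooth_differentiable sB Du).
Qed.

Lemma sum_frame_coef m s i u (y : fidx -> R) :
  \sum_b frame_coef m (s, i) b u * y b =
  coef_sign c s * \sum_l B m i l u * y (~~ s, l).
Proof.
transitivity (\sum_s' \sum_l frame_coef m (s, i) (s', l) u * y (s', l)).
  by rewrite pair_bigA; apply: eq_bigr => -[].
rewrite big_bool /frame_coef /= mulr_sumr; case: s => /=.
  rewrite [X in X + _]big1 ?add0r => [|l _]; last by rewrite mul0r.
  by apply: eq_bigr => l _; rewrite mulrA.
rewrite [X in _ + X]big1 ?addr0 => [|l _]; last by rewrite mul0r.
by apply: eq_bigr => l _; rewrite mulrA.
Qed.

Lemma structure_equations_coord W fr k : structure_equations W fr ->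
  total_linear W frame_coef (fun a v => fr a.1 a.2 v 0 k).
Proof.
move=> frP [s i] u Wu; have [df pf] := frP u Wu s i.
split=> [|m]; first by have /differentiable_rowP := df; apply.
rewrite sum_frame_coef pd_row // pf summxE mulr_sumr.
by apply: eq_bigr => l _; rewrite mxE mulrA.
Qed.

Lemma frame_unique W fr fr' u0 : open W -> connected W -> W `<=` D ->
  structure_equations W fr -> structure_equations W fr' -> W u0 ->
  (forall s i, fr s i u0 = fr' s i u0) ->
  forall u, W u -> forall s i, fr s i u = fr' s i u.
Proof.
move=> oW cW WD frP frP' Wu0 init u Wu s i; apply/rowP => k; apply/eqP.
rewrite -subr_eq0; apply/eqP.
apply: (@total_linear_unique R N fidx W frame_coef
  (fun a v => fr a.1 a.2 v 0 k - fr' a.1 a.2 v 0 k) u0 oW cW _ _ Wu0 _ u Wu (s, i)).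
- by move=> m a b v Wv; apply: frame_coef_continuous; exact: WD.
- move=> a v Wv; have [d1 p1] := structure_equations_coord k frP a Wv.
  have [d2 p2] := structure_equations_coord k frP' a Wv.
  split=> [|m]; first exact: differentiableB.
  rewrite pdB // p1 p2 -sumrB.
  by apply: eq_bigr => b _; rewrite mulrBr.
- by move=> a; rewrite init subrr.
Qed.

Definition frame_gram (a b : fidx) : R :=
  if a.1 == b.1 then (if a.1 then 1 else c^-1) * eta a.2 b.2 else 0.

(** The scalar product of the derivative of one frame vector with another frame vector, when the
    frame has the prescribed Gram matrix. The factors [c] and [c^-1] cancel and leave a third
    derivative of [Phi], up to sign. *)
Lemma sum_struct_gram m s i s' j u :
  coef_sign c s * \sum_l B m i l u * frame_gram (~~ s, l) (s', j) =
  if s' == ~~ s then (if s then 1 else -1) * D3 Phi m i j u else 0.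
Proof.
have scalec (x y : R) : c * (x * (c^-1 * y)) = 1 * (x * y).
  by rewrite mul1r mulrCA mulVKf.
rewrite /frame_gram /= eq_sym; case: eqP => _; last first.
  by rewrite big1 ?mulr0 // => l _; rewrite mulr0.
rewrite -(struct_coef_lower Phi eta_nondeg) !mulr_sumr; apply: eq_bigr => l _.
by case: (s); rewrite /coef_sign /= ?scalec // mul1r.
Qed.

Lemma frame_gramC a b : frame_gram a b = frame_gram b a.
Proof.
have [etaT _] := eta_nondeg.
by rewrite /frame_gram eq_sym -[in LHS]etaT mxE; case: eqP => [->|].
Qed.

(** The two contributions have opposite signs, one from the tangent and one from the normal vector,
    and are equal up to sign by symmetry of [D3] in its last two indices. *)
Lemma frame_gram_invariant m a b u : D u ->
  \sum_d frame_coef m a d u * frame_gram d b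
  + \sum_d frame_coef m b d u * frame_gram a d = 0.
Proof.
move=> Du; have D3C i j : D3 Phi m i j u = D3 Phi m j i u := D3C23 oD sPhi m i j Du.
case: a b => s i [s' j]; rewrite !sum_frame_coef.
rewrite sum_struct_gram.
have -> : coef_sign c s' * \sum_l B m j l u * frame_gram (s, i) (~~ s', l) =
    if s == ~~ s' then (if s' then 1 else -1) * D3 Phi m j i u else 0.
  rewrite -sum_struct_gram; congr (_ * _).
  by apply: eq_bigr => l _; rewrite frame_gramC.
have -> : (s == ~~ s') = (s' == ~~ s) by case: (s) (s') => -[].
rewrite (D3C j i); case: eqP => [->|_]; last by rewrite addr0.
by case: (s); rewrite /= ?mul1r !mulN1r ?addrN ?addNr.
Qed.

Lemma frame_gram_conserved (G : 'M[R]_(N + N)) W fr u0 : open W -> connected W ->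
  W `<=` D -> G^T = G -> structure_equations W fr -> W u0 ->
  (forall a b, dot G (fr a.1 a.2 u0) (fr b.1 b.2 u0) = frame_gram a b) ->
  forall u, W u -> forall a b, dot G (fr a.1 a.2 u) (fr b.1 b.2 u) = frame_gram a b.
Proof.
move=> oW cW WD GT frP Wu0 init u Wu a b; apply/eqP; rewrite -subr_eq0; apply/eqP.
(* The Leibniz rule: on pairs of frame indices the coefficient matrix acts on each factor in
   turn. *)
pose C m (p q : fidx * fidx) v : R :=
  (if q.2 == p.2 then frame_coef m p.1 q.1 v else 0) +
  (if q.1 == p.1 then frame_coef m p.2 q.2 v else 0).
pose y (p : fidx * fidx) v :=
  dot G (fr p.1.1 p.1.2 v) (fr p.2.1 p.2.2 v) - frame_gram p.1 p.2.
have sumC m p v (z : fidx * fidx -> R) : \sum_q C m p q v * z q =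
    \sum_d frame_coef m p.1 d v * z (d, p.2) +
    \sum_d frame_coef m p.2 d v * z (p.1, d).
  under eq_bigr do rewrite mulrDl.
  rewrite big_split /=; congr (_ + _).
    transitivity (\sum_d \sum_d'
        (if d' == p.2 then frame_coef m p.1 d v else 0) * z (d, d')).
      by rewrite pair_bigA; apply: eq_bigr => -[].
    apply: eq_bigr => d _; rewrite (bigD1 p.2) //= eqxx big1 ?addr0 // => d' dp.
    by rewrite (negbTE dp) mul0r.
  transitivity (\sum_d \sum_d'
      (if d == p.1 then frame_coef m p.2 d' v else 0) * z (d, d')).
    by rewrite pair_bigA; apply: eq_bigr => -[].
  rewrite (bigD1 p.1) //= [X in _ + X]big1 ?addr0 => [|d dp].
    by apply: eq_bigr => d' _; rewrite eqxx.
  by rewrite big1 // => d' _; rewrite (negbTE dp) mul0r.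
have split4 (f f' X g X' g' : fidx -> R) :
    \sum_d f d * (X d - g d) + \sum_d f' d * (X' d - g' d) =
    (\sum_d f d * X d + \sum_d f' d * X' d)
    - (\sum_d f d * g d + \sum_d f' d * g' d).
  rewrite opprD addrACA -!sumrB.
  by congr (_ + _); apply: eq_bigr => d _; rewrite mulrBr.
apply: (@total_linear_unique R N _ W C y u0 oW cW _ _ Wu0 _ u Wu (a, b)).
- move=> m p q v /WD Dv; rewrite /C; apply: (@continuousD _ R _).
    by case: eqP => _; [exact: frame_coef_continuous|exact: cst_continuous].
  by case: eqP => _; [exact: frame_coef_continuous|exact: cst_continuous].
- move=> [[s i] [s' j]] v Wv; have [d1 p1] := frP v Wv s i.
  have [d2 p2] := frP v Wv s' j.
  have dc : differentiable (fun _ : vec => frame_gram (s, i) (s', j)) v.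
    exact: differentiable_cst.
  have dd := differentiable_dot G d1 d2.
  split=> [|m]; first exact: differentiableB.
  rewrite /y /= pdB // pd_cst subr0 pd_dot // p1 p2 sumC /=.
  rewrite split4 (frame_gram_invariant m (s, i) (s', j) (WD v Wv)) subr0.
  rewrite !sum_frame_coef dot_suml dot_sumr !mulr_sumr; congr (_ + _).
    by apply: eq_bigr => l _; rewrite dotZl mulrA.
  by apply: eq_bigr => l _; rewrite dotZr mulrA.
- by move=> [a' b']; rewrite /y init subrr.
Qed.

End StructureEquations.

(** * Gauss and Weingarten equations of a realizing submanifold *)

Section RealizingSubmanifolds.
Variables (R : realType) (N : nat).
Local Notation vec := 'rV[R]_N.
Local Notation amb := 'rV[R]_(N + N).
Local Notation fidx := (bool * 'I_N)%type.
Variables (D : set vec) (eta : 'M[R]_N) (Phi : vec -> R).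
Hypothesis oD : open D.
Hypothesis eta_nondeg : nondeg_sym eta.
Hypothesis sPhi : smooth D Phi.
Variable c : R.
Hypothesis c0 : c != 0.
Implicit Types (i j l m : 'I_N) (u : vec) (s : bool) (V W : set vec).
Implicit Types (fr : bool -> 'I_N -> vec -> amb) (G : 'M[R]_(N + N)).
Implicit Types (r n : vec -> amb) (nu : 'I_N -> vec -> amb).
Local Notation B := (struct_coef eta Phi).

Definition geo_frame r nu s i : vec -> amb := if s then pd i r else nu i.

Definition frame_mx fr u : 'M[R]_(N + N) :=
  col_mx (\matrix_i fr true i u) (\matrix_i fr false i u).

Definition gram_mx : 'M[R]_(N + N) := block_mx eta 0 0 (c^-1 *: eta).

Lemma row_frame_mx fr u s i :
  row (if s then lshift N i else rshift N i) (frame_mx fr u) = fr s i u.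
Proof. by case: s; rewrite ?rowKu ?rowKd rowK. Qed.

Lemma gram_mxP fr G u :
  (forall a b : fidx, dot G (fr a.1 a.2 u) (fr b.1 b.2 u) = frame_gram eta c a b) <->
  frame_mx fr u *m G *m (frame_mx fr u)^T = gram_mx.
Proof.
have E s i s' j : gram_mx (if s then lshift N i else rshift N i)
    (if s' then lshift N j else rshift N j) = frame_gram eta c (s, i) (s', j).
  rewrite /gram_mx /frame_gram /=; case: s; case: s' => /=.
  - by rewrite block_mxEul mul1r.
  - by rewrite block_mxEur mxE.
  - by rewrite block_mxEdl mxE.
  - by rewrite block_mxEdr mxE.
split=> [H|H [s i] [s' j]]; last first.
  by rewrite -E -H gram_mxE !row_frame_mx.
apply/matrixP => p q.
have ord_bool (k : 'I_(N + N)) : exists s i, k = if s then lshift N i else rshift N i.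
  by case: (split_ordP k) => i ->; [exists true, i|exists false, i].
have [s [i ->]] := ord_bool p; have [s' [j ->]] := ord_bool q.
by rewrite gram_mxE !row_frame_mx E; exact: (H (s, i) (s', j)).
Qed.

Lemma gram_mx_unit : gram_mx \in unitmx.
Proof.
have [_ etaU] := eta_nondeg.
rewrite unitmxE det_ublock unitrM -!unitmxE etaU /=.
by rewrite unitmxZ // unitfE invr_eq0.
Qed.

Lemma frame_mx_unit fr G u :
  frame_mx fr u *m G *m (frame_mx fr u)^T = gram_mx -> frame_mx fr u \in unitmx.
Proof.
by move=> H; move: gram_mx_unit; rewrite -H !unitmx_mul => /andP[/andP[]].
Qed.

(** An invertible Gram matrix makes the frame a basis of the ambient space, where [G] is
    nondegenerate. *)
Lemma frame_ext fr G u x y : G \in unitmx ->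
  frame_mx fr u *m G *m (frame_mx fr u)^T = gram_mx ->
  (forall s i, dot G x (fr s i u) = dot G y (fr s i u)) -> x = y.
Proof.
move=> GU /frame_mx_unit FU H.
have E (z : amb) k : (z *m G *m (frame_mx fr u)^T) 0 k = dot G z (row k (frame_mx fr u)).
  by rewrite /dot !mxE; apply: eq_bigr => p _; rewrite !mxE.
have : x *m G *m (frame_mx fr u)^T = y *m G *m (frame_mx fr u)^T.
  apply/rowP => k; rewrite !E.
  by case: (split_ordP k) => i ->; [have := H true i|have := H false i];
    rewrite -row_frame_mx.
move=> /(congr1 (fun z => z *m invmx (frame_mx fr u)^T *m invmx G)).
by rewrite !mulmxK // unitmx_tr.
Qed.

Lemma solves_structure V r n : open V -> solves V eta Phi c r n ->
  structure_equations eta Phi c V (geo_frame r (fun l => pd l n)).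
Proof.
move=> oV sol; have [sr sn H] := (solvesE eta Phi V c r n).1 sol.
have sf s : smooth V (if s then r else n) by case: s.
have E s i : geo_frame r (fun l => pd l n) s i = pd i (if s then r else n).
  by rewrite /geo_frame; case: s.
move=> u Vu s i; rewrite E; split=> [|m].
  exact: (smooth_differentiable (smooth_pd i (sf s)) Vu).
apply/rowP => q; apply: (etrans (H u Vu s m i q)).
rewrite summxE mulr_sumr; apply: eq_bigr => l _; rewrite E.
by rewrite [RHS]mxE mulrA.
Qed.

Lemma realizes_gram V G r nu u : realizes V G eta Phi c r nu -> V u ->
  normal_gram G nu u = c^-1 *: eta /\
  forall a b : fidx, dot G (geo_frame r nu a.1 a.2 u) (geo_frame r nu b.1 b.2 u) =
    frame_gram eta c a b.
Proof.
move=> [[[_ [GT _] _ _] _ _] [[_ nuT _] _ _] H] Vu.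
have [_ etaU] := eta_nondeg; have [I1 I2 _] := H u Vu.
(* [invmx] leaves singular matrices unchanged, so invertibility has to be read off from the
   prescribed inverse. *)
have muU : normal_gram G nu u \in unitmx.
  by rewrite -unitmx_inv I2 unitmxZ ?unitfE // unitmx_inv.
have mu : normal_gram G nu u = c^-1 *: eta.
  by rewrite -[LHS]invmxK I2 invmxZ ?invmxK // unitmxZ ?unitfE // unitmx_inv.
split=> // -[s i] [s' j]; rewrite /geo_frame /frame_gram /=.
case: s; case: s' => /=.
- by rewrite mul1r -[in RHS]I1 mxE.
- by rewrite dotC // nuT.
- by rewrite nuT.
- by have := congr1 (fun A : 'M[R]_N => A i j) mu; rewrite !mxE.
Qed.

Lemma pd_commV V r i j u : open V -> smooth V r -> V u ->
  pd i (pd j r) u = pd j (pd i r) u.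
Proof.
move=> oV sr Vu; apply/rowP => k.
have E i' j' : pd i' (pd j' r) u 0 k = pd i' (pd j' (fun v => r v 0 k)) u.
  rewrite -(pd_row i' k (smooth_differentiable (smooth_pd j' sr) Vu)).
  apply: (pd_eq i' oV _ Vu) => v Vv.
  by rewrite (pd_row j' k (smooth_differentiable sr Vv)).
have sk := (smooth_rowP r oV).1 sr k.
exact (etrans (E i j) (etrans (pd_comm i j oV sk Vu) (esym (E j i)))).
Qed.

(* The uniqueness argument of the Levi-Civita connection. *)
Lemma sym_antisym0 (I : Type) (a : I -> I -> I -> R) :
  (forall x y z, a x y z = a y x z) -> (forall x y z, a x y z = - a x z y) ->
  forall x y z, a x y z = 0.
Proof.
move=> sym anti x y z; have E : a x y z = - a x y z.
  by rewrite {1}anti sym anti opprK sym anti sym.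
by apply/eqP; move: E => /eqP; rewrite -addr_eq0 -mulr2n mulrn_eq0.
Qed.

(** By [frame_ext] it suffices to take scalar products with the frame. Tangential parts of second
    derivatives of [r] vanish because the metric is constant, their normal parts are the second
    fundamental forms; tangential parts of derivatives of normals follow by differentiating
    orthogonality, and their normal parts vanish by absence of torsion. *)
Lemma realizes_structure V G r nu : V `<=` D -> realizes V G eta Phi c r nu ->
  structure_equations eta Phi c V (geo_frame r nu).
Proof.
move=> VD Hr; have gramr u (Vu : V u) := (realizes_gram Hr Vu).2.
have [[[oV [GT GU] sr _] _ _] [[snu nuT _] _ tors] H] := Hr.
have dr2 i u : V u -> differentiable (pd i r) u.
  by move=> Vu; exact: smooth_differentiable (smooth_pd i sr) Vu.
have dnu i u : V u -> differentiable (nu i) u.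
  by move=> Vu; exact: smooth_differentiable (snu i) Vu.
have pd_dot0 (f g : vec -> amb) (a : R) m u : V u ->
    differentiable f u -> differentiable g u ->
    (forall v, V v -> dot G (f v) (g v) = a) ->
    dot G (pd m f u) (g u) = - dot G (f u) (pd m g u).
  move=> Vu df dg fg; apply/eqP; rewrite -addr_eq0 -(pd_dot G m df dg).
  by rewrite (pd_eq m oV fg Vu) pd_cst.
have tangent i j m u : V u -> dot G (pd m (pd i r) u) (pd j r u) = 0.
  move=> Vu; have metric i' j' v : V v -> dot G (pd i' r v) (pd j' r v) = eta i' j'.
    by move=> Vv; have [I1 _ _] := H v Vv; rewrite -[in RHS]I1 mxE.
  apply: (sym_antisym0 (a := fun m i j => dot G (pd m (pd i r) u) (pd j r u)))
    => m' i' j'.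
    exact (congr1 (fun x => dot G x (pd j' r u)) (pd_commV m' i' oV sr Vu)).
  have X := pd_dot0 _ _ _ m' u Vu (dr2 i' u Vu) (dr2 j' u Vu) (metric i' j').
  exact (etrans X (congr1 -%R (dotC (pd i' r u) (pd m' (pd j' r) u) GT))).
have second i j m u : V u -> dot G (pd m (pd i r) u) (nu j u) = D3 Phi m i j u.
  move=> Vu; have [_ _ S] := H u Vu; have Du := VD _ Vu.
  have F : second_form G r nu j u m i = dot G (nu j u) (pd m (pd i r) u) by rewrite mxE.
  exact (etrans (dotC _ _ GT) (etrans (esym F) (etrans (S j m i)
    (etrans (D3C12 oD sPhi j m i Du) (D3C23 oD sPhi m j i Du))))).
move=> u Vu s i; split=> [|m].
  by rewrite /geo_frame; case: s; [exact: dr2|exact: dnu].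
apply: (frame_ext GU ((gram_mxP _ _ _).1 (gramr u Vu))) => s' j.
rewrite dot_suml (eq_bigr (fun l => coef_sign c s *
    (B m i l u * frame_gram eta c (~~ s, l) (s', j)))); last first.
  by move=> l _; rewrite dotZl -mulrA (gramr u Vu (~~ s, l) (s', j)).
rewrite -mulr_sumr (sum_struct_gram Phi eta_nondeg c0).
rewrite /geo_frame; case: s; case: s' => /=.
- exact: tangent.
- by rewrite mul1r; exact: second.
- have orth v : V v -> dot G (nu i v) (pd j r v) = 0 by move=> Vv; exact: nuT.
  apply: (etrans (pd_dot0 _ _ _ m u Vu (dnu i u Vu) (dr2 j u Vu) orth)).
  rewrite mulN1r; congr (- _).
  exact (etrans (dotC _ _ GT) (etrans (second j i m u Vu)
    (D3C23 oD sPhi m j i (VD _ Vu)))).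
- exact: tors.
Qed.

End RealizingSubmanifolds.

(** * Levi-Civita connection of a constant metric *)

Section ConstantMetric.
Variables (R : realType) (N : nat).
Local Notation vec := 'rV[R]_N.
Variables (V : set vec) (eta : 'M[R]_N) (g : vec -> 'M[R]_N).
Hypothesis oV : open V.
Hypothesis gV : forall u, V u -> g u = eta.

Lemma christoffel_constant k i j u : V u -> christoffel g k i j u = 0.
Proof.
move=> Vu; have p0 m p q : pd m (fun v => g v p q) u = 0.
  rewrite (pd_eq m oV (g := fun=> eta p q) _ Vu) ?pd_cst // => v Vv.
  by rewrite gV.
rewrite /christoffel big1 ?mulr0 // => l _.
by rewrite !p0 addr0 subr0 mulr0.
Qed.

Lemma flat_metric_constant : flat_metric V g.
Proof.
move=> u Vu l k i j.
have p0 m a b d : pd m (christoffel g a b d) u = 0.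
  rewrite (pd_eq m oV (g := fun=> 0) _ Vu) ?pd_cst // => v Vv.
  exact: christoffel_constant.
rewrite /riemann !p0 subr0 add0r big1 // => m _.
by rewrite !(christoffel_constant _ _ _ Vu) mul0r subr0.
Qed.

Lemma nabla3_constant f i j k u : V u -> nabla3 g f i j k u = D3 f i j k u.
Proof.
move=> Vu; have n2 a b v : V v -> nabla2 g f a b v = pd a (pd b f) v.
  move=> Vv; rewrite /nabla2 big1 ?subr0 // => l _.
  by rewrite (christoffel_constant _ _ _ Vv) mul0r.
rewrite /nabla3 (pd_eq i oV (n2 j k) Vu) big1 => [|l _]; last first.
  by rewrite (christoffel_constant _ _ _ Vu) mul0r.
rewrite subr0 big1 ?subr0 // => l _.
by rewrite (christoffel_constant _ _ _ Vu) mul0r.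
Qed.

End ConstantMetric.

(** * Correspondence between solutions and realizing submanifolds *)

Section SolutionsAndSubmanifolds.
Variables (R : realType) (N : nat).
Local Notation vec := 'rV[R]_N.
Local Notation amb := 'rV[R]_(N + N).
Local Notation fidx := (bool * 'I_N)%type.
Variables (D : set vec) (eta : 'M[R]_N) (Phi : vec -> R).
Hypothesis oD : open D.
Hypothesis eta_nondeg : nondeg_sym eta.
Hypothesis sPhi : smooth D Phi.
Variable c : R.
Hypothesis c0 : c != 0.
Implicit Types (i j l m : 'I_N) (u : vec) (s : bool) (V W : set vec).
Implicit Types (fr : bool -> 'I_N -> vec -> amb) (G : 'M[R]_(N + N)).
Implicit Types (r n : vec -> amb) (nu : 'I_N -> vec -> amb).
Local Notation B := (struct_coef eta Phi).

Lemma row_free_gram (K M : nat) (F : 'M[R]_(K, M)) (G : 'M[R]_M) :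
  F *m G *m F^T \in unitmx -> row_free F.
Proof.
move=> U; apply/row_freeP; exists (G *m F^T *m invmx (F *m G *m F^T)).
by rewrite !mulmxA mulmxV.
Qed.

Lemma solution_realizes V G r n u0 : open V -> connected V -> V `<=` D ->
  V u0 -> nondeg_sym G -> solves V eta Phi c r n ->
  (forall i j, [/\ dot G (pd i r u0) (pd j r u0) = eta i j,
                   dot G (pd i r u0) (pd j n u0) = 0
                 & dot G (pd i n u0) (pd j n u0) = c^-1 * eta i j]) ->
  realizes V G eta Phi c r (fun l => pd l n).
Proof.
move=> oV cV VD Vu0 GG sol init; have [GT GU] := GG.
have [sr sn _] := sol; have [_ etaU] := eta_nondeg.
have frP := solves_structure oV sol.
have gram u (Vu : V u) : forall a b : fidx,
    dot G (geo_frame r (fun l => pd l n) a.1 a.2 u)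
          (geo_frame r (fun l => pd l n) b.1 b.2 u) = frame_gram eta c a b.
  apply: (frame_gram_conserved oD eta_nondeg sPhi c0 oV cV VD GT frP Vu0 _ Vu).
  move=> [s i] [s' j]; rewrite /frame_gram /geo_frame /=.
  have [I1 I2 I3] := init i j; have [_ J2 _] := init j i.
  by case: s; case: s' => /=;
    [rewrite mul1r; exact: I1|exact: I2|rewrite dotC //; exact: J2|exact: I3].
have ff u : V u -> first_form G r u = eta.
  move=> Vu; apply/matrixP => i j; rewrite mxE.
  by rewrite [LHS](gram u Vu (true, i) (true, j)) /frame_gram /= mul1r.
have tn u : V u -> forall i j, dot G (pd i r u) (pd j n u) = 0.
  by move=> Vu i j; exact: (gram u Vu (true, i) (false, j)).
have nn u : V u -> normal_gram G (fun l => pd l n) u = c^-1 *: eta.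
  move=> Vu; apply/matrixP => i j; rewrite !mxE.
  exact: (gram u Vu (false, i) (false, j)).
have sf u : V u -> forall m i j,
    second_form G r (fun l => pd l n) m u i j = D3 Phi m i j u.
  move=> Vu m i j; rewrite mxE dotC //.
  have [_ pf] := frP u Vu true j; rewrite [pd i _ u](pf i) dot_suml.
  rewrite (eq_bigr (fun l => c * (B i j l u * frame_gram eta c (false, l) (false, m)))).
    rewrite -mulr_sumr (sum_struct_gram Phi eta_nondeg c0 i true j false m u) /= mul1r.
    rewrite (D3C23 oD sPhi i j m (VD _ Vu)); exact: (D3C12 oD sPhi i m j (VD _ Vu)).
  by move=> l _; rewrite dotZl -mulrA (gram u Vu (false, l) (false, m)).
have tf : torsionless_frame V G r (fun l => pd l n).
  split.
  - split=> [a|u Vu a i|u Vu]; first exact: smooth_pd.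
      by rewrite dotC // tn.
    apply: (@row_free_gram _ _ _ G); have -> : (\matrix_a pd a n u) *m G *m
        (\matrix_a pd a n u)^T = normal_gram G (fun l => pd l n) u.
      by apply/matrixP => i j; rewrite gram_mxE !rowK mxE.
    by rewrite nn // unitmxZ // unitfE invr_eq0.
  - by exists (c^-1 *: eta).
  - move=> u Vu i a b; have [_ pf] := frP u Vu false a.
    rewrite [pd i _ u](pf i) dot_suml big1 // => l _.
    by rewrite dotZl (gram u Vu (true, l) (false, b)) mulr0.
split=> // [|u Vu]; last first.
  split=> //; [exact: ff| |exact: sf].
  by rewrite nn // invmxZ ?invrK // unitmxZ // unitfE invr_eq0.
split.
- by split=> // u Vu; rewrite ff.
- exact: flat_metric_constant oV ff.
- exists (fun l => pd l n); split=> // v Vv.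
  (* In flat coordinates covariant third derivatives are ordinary ones, so [Phi] itself is a
     potential. *)
  exists V, Phi; split=> //; first exact: smooth_sub VD sPhi.
  move=> u Vu i j k; rewrite sf //.
  by apply/esym; exact: nabla3_constant oV ff _ _ _ _ _ Vu.
Qed.

Lemma local_realization : associativity D eta Phi -> forall u0, D u0 ->
  exists (V : set vec) (G : 'M[R]_(N + N)) (r n : vec -> amb),
  [/\ open V, V u0, V `<=` D, solves V eta Phi c r n
    & realizes V G eta Phi c r (fun l => pd l n)].
Proof.
move=> H u0 Du0; have [etaT etaU] := eta_nondeg.
have [rho rho0 [sub ex]] := associativity_local_solutions oD eta_nondeg sPhi c0 H Du0.
(* The initial frame is the standard basis, and the ambient form is chosen to be the Gram matrix
   prescribed for it; the initial positions are arbitrary. *)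
have [r [n [sol [_ _ r1 n1]]]] := ex 0 0 (fun i => delta_mx 0 (lshift N i))
  (fun i => delta_mx 0 (rshift N i)).
pose G := gram_mx eta c.
have GG : nondeg_sym G.
  split; last exact: gram_mx_unit.
  by rewrite /G /gram_mx tr_block_mx !trmx0 linearZ /= etaT.
have Gd p q : dot G (delta_mx 0 p) (delta_mx 0 q) = G p q.
  by rewrite /dot -rowE trmx_delta -colE !mxE.
exists (ball u0 rho), G, r, n; have oW : open (ball u0 rho) by exact: ball_open.
have Wu0 : ball u0 rho u0 by exact: ballxx.
split=> //; apply: solution_realizes Wu0 GG sol _ => //; first exact: connected_ball.
move=> i j; rewrite !r1 !n1 !Gd /G /gram_mx.
by rewrite block_mxEul block_mxEur block_mxEdr !mxE.
Qed.

(** The system is solved with the values of [pd i r] and [nu i] at [u0], and [frame_unique]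
    identifies the frame of the solution with the given one. The given [r] may then replace the
    solution [r'], since only derivatives of [r] occur in the equations. *)
Lemma realizes_local_potential V G r nu : associativity D eta Phi ->
  V `<=` D -> realizes V G eta Phi c r nu -> forall u0, V u0 ->
  exists (W : set vec) n,
    [/\ open W, W u0, W `<=` V, solves W eta Phi c r n
      & forall u, W u -> forall l, nu l u = pd l n u].
Proof.
move=> H VD Hr u0 Vu0; have frP := realizes_structure oD eta_nondeg sPhi c0 VD Hr.
have [[[oV _ sr _] _ _] [[snu _ _] _ _] _] := Hr.
have [rho rho0 [sub ex]] := associativity_local_solutions oV eta_nondeg
  (smooth_sub VD sPhi) c0 (fun u Vu => H u (VD u Vu)) Vu0.
have [r' [n [sol [_ _ r1 n1]]]] := ex 0 0 (fun i => pd i r u0) (fun i => nu i u0).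
have oW : open (ball u0 rho) by exact: ball_open.
have Wu0 : ball u0 rho u0 by exact: ballxx.
have frW : structure_equations eta Phi c (ball u0 rho) (geo_frame r nu).
  by move=> u /sub Vu; exact: frP.
have same := @frame_unique R N D eta Phi oD sPhi c (ball u0 rho)
  (geo_frame r nu) (geo_frame r' (fun l => pd l n)) u0 oW (connected_ball rho0)
  (subset_trans sub VD) frW (solves_structure oW sol) Wu0.
have {}same u : ball u0 rho u -> (forall i, pd i r u = pd i r' u) /\
    forall l, nu l u = pd l n u.
  move=> Wu; have {}same := same _ u Wu.
  have init s i : geo_frame r nu s i u0 = geo_frame r' (fun l => pd l n) s i u0.
    by case: s; [exact/esym/r1|exact/esym/n1].
  by split=> i; [exact: (same init true i)|exact: (same init false i)].
have [_ sn sys] := sol; exists (ball u0 rho), n.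
split; [exact: oW|exact: Wu0|exact: sub| |by move=> u /same[]].
split; [exact: smooth_sub sub sr|exact: sn|move=> u Wu i j].
have [Hr1 Hn1] := sys u Wu i j; split.
  exact: etrans (pd_eq i oW (fun v Wv => (same v Wv).1 j) Wu) Hr1.
apply: (etrans Hn1); congr (- _); apply: eq_bigr => k _; apply: eq_bigr => l _.
by congr (_ *: _); exact/esym/(same u Wu).1.
Qed.

Lemma realizes_unique V G G' r r' nu nu' : V `<=` D -> connected V -> V !=set0 ->
  realizes V G eta Phi c r nu -> realizes V G' eta Phi c r' nu' ->
  exists (A : 'M[R]_(N + N)) (b : amb),
    (forall x y, dot G' (x *m A) (y *m A) = dot G x y) /\
    forall u, V u -> r' u = r u *m A + b /\ forall l, nu' l u = nu l u *m A.
Proof.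
move=> VD cV [u0 Vu0] Hr Hr'.
have frP := realizes_structure oD eta_nondeg sPhi c0 VD Hr.
have frP' := realizes_structure oD eta_nondeg sPhi c0 VD Hr'.
have [[[oV _ sr _] _ _] _ _] := Hr; have [[[_ _ sr' _] _ _] _ _] := Hr'.
pose fr := geo_frame r nu; pose fr' := geo_frame r' nu'.
have gm := (gram_mxP eta c fr G u0).1 (realizes_gram eta_nondeg c0 Hr Vu0).2.
have gm' := (gram_mxP eta c fr' G' u0).1 (realizes_gram eta_nondeg c0 Hr' Vu0).2.
have FU := frame_mx_unit eta_nondeg c0 gm.
set F := frame_mx fr u0 in gm FU; set F' := frame_mx fr' u0 in gm'.
(* Vectors being rows, [A] carries the first frame at [u0] to the second; equality of their Gram
   matrices makes it an isometry. *)
pose A := invmx F *m F'.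
have AG : A *m G' *m A^T = G.
  rewrite /A trmx_mul -!mulmxA (mulmxA F') (mulmxA _ F'^T) gm' -gm.
  by rewrite trmx_inv !mulmxA mulVmx // mul1mx mulmxK // unitmx_tr.
have dA (f : vec -> amb) u : differentiable f u ->
    differentiable (fun v => f v *m A) u /\
    forall i, pd i (fun v => f v *m A) u = pd i f u *m A.
  move=> df; have dfk := (differentiable_rowP f u).1 df.
  have E k : (fun v => (f v *m A) 0 k) = (fun v => \sum_p f v 0 p * A p k).
    by apply/funext => v; rewrite mxE.
  have dc p k : differentiable (fun _ : vec => A p k) u by exact: differentiable_cst.
  have d : differentiable (fun v => f v *m A) u.
    apply/differentiable_rowP => k; rewrite E; apply: differentiable_fsum => p.
    exact: (@differentiableM R vec (fun v => f v 0 p) (fun=> A p k)).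
  split=> // i; apply/rowP => k; rewrite -pd_row // E pd_sumM // mxE.
  by apply: eq_bigr => p _; rewrite pd_cst mulr0 add0r pd_row.
have frA : structure_equations eta Phi c V (fun s i u => fr s i u *m A).
  move=> u Vu s i; have [df pf] := frP u Vu s i; have [d p] := dA _ _ df.
  split=> // m; rewrite p pf mulmx_suml.
  by apply: eq_bigr => l _; rewrite scalemxAl.
have init s i : fr s i u0 *m A = fr' s i u0.
  by rewrite -!row_frame_mx -row_mul /A mulKVmx.
have same := frame_unique oD sPhi oV cV VD frA frP' Vu0 init.
exists A, (r' u0 - r u0 *m A); split=> [x y|u Vu].
  rewrite /dot -[in RHS]AG trmx_mul !mulmxA; by [].
split=> [|l]; last exact: (esym (same u Vu false l)).
have dr v : V v -> differentiable r v by move=> Vv; exact: smooth_differentiable sr Vv.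
have dr' v : V v -> differentiable r' v by move=> Vv; exact: smooth_differentiable sr' Vv.
have := @pd_eq0_constant R N _ V (fun v => r' v - r v *m A) u0 oV cV _ _ Vu0 u Vu.
move=> const; apply/eqP; rewrite addrC -subr_eq; apply/eqP; apply: const => v Vv.
  by apply: differentiableB; [exact: dr'|have [] := dA r v (dr v Vv)].
move=> i; have [d p] := dA r v (dr v Vv); rewrite pdB ?p //; last exact: dr'.
by apply/eqP; rewrite subr_eq0 eq_sym; apply/eqP; exact: (same v Vv true i).
Qed.

(** The parameter [c] sits in the Gram matrix of the normals alone, while the structure functions
    combine second fundamental forms, equal to third derivatives of [Phi], with the inverse of the
    first fundamental form [eta]. *)
Lemma realizes_induced_mul V G r nu u mul X Y : V `<=` D ->
  frobenius_multiplication D eta mul -> given_by D eta mul Phi ->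
  realizes V G eta Phi c r nu -> V u -> induced_mul G r nu u X Y = mul u X Y.
Proof.
move=> VD fm gb [_ _ H] Vu; have Du := VD _ Vu; have [ff _ sf] := H u Vu.
have mul0 Z : mul u 0 Z = 0.
  have := fm_linear fm Du 1 0 0 Z; rewrite scaler0 addr0 scale1r.
  by move=> /eqP; rewrite -subr_eq0 opprD addNKr oppr_eq0 => /eqP.
have mulZ a Z T : mul u (a *: Z) T = a *: mul u Z T.
  by have := fm_linear fm Du a Z 0 T; rewrite addr0 mul0 addr0.
have mulD Z1 Z2 T : mul u (Z1 + Z2) T = mul u Z1 T + mul u Z2 T.
  by have := fm_linear fm Du 1 Z1 Z2 T; rewrite !scale1r.
have mul_sum (F : 'I_N -> vec) T : mul u (\sum_i F i) T = \sum_i mul u (F i) T.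
  exact: (big_morph (fun Z => mul u Z T) (fun Z1 Z2 => mulD Z1 Z2 T) (mul0 T)).
have -> : mul u X Y = \sum_i \sum_j (X 0 i * Y 0 j) *:
    mul u (delta_mx 0 i) (delta_mx 0 j).
  rewrite {1}[X]row_sum_delta mul_sum; apply: eq_bigr => i _.
  rewrite mulZ (fm_comm fm Du) {1}[Y]row_sum_delta mul_sum scaler_sumr.
  by apply: eq_bigr => j _; rewrite mulZ scalerA (fm_comm fm Du).
apply/rowP => k; rewrite mxE summxE; apply: eq_bigr => i _.
rewrite summxE; apply: eq_bigr => j _; rewrite mxE.
have -> : mul u (delta_mx 0 i) (delta_mx 0 j) 0 k =
    \sum_s invmx eta k s * D3 Phi s i j u.
  rewrite (gb u Du) summxE (bigD1 k) //= [X in _ + X]big1 ?addr0 => [|l lk].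
    by rewrite summxE; apply: eq_bigr => s _; rewrite !mxE !eqxx mulr1.
  rewrite summxE big1 // => s _.
  by rewrite !mxE eqxx eq_sym (negbTE lk) mulr0.
rewrite mulr_sumr; apply: eq_bigr => s _.
by rewrite ff sf -mulrA mulrC.
Qed.

End SolutionsAndSubmanifolds.

(** * Inertia of symmetric forms *)

Section Signature.
Variable R : realType.

Definition positive_on (M k : nat) (G : 'M[R]_M) (B : 'M[R]_(k, M)) : Prop :=
  forall x : 'rV[R]_k, x != 0 -> 0 < dot G (x *m B) (x *m B).

Lemma dotN (M : nat) (G : 'M[R]_M) x y : dot (- G) x y = - dot G x y.
Proof. by rewrite /dot mulmxN mulNmx mxE. Qed.

Lemma dot0l (M : nat) (G : 'M[R]_M) x : dot G 0 x = 0.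
Proof. by rewrite /dot !mul0mx mxE. Qed.

Lemma dot_congr (M k : nat) (G : 'M[R]_M) (P : 'M[R]_(k, M)) x y :
  dot (P *m G *m P^T) x y = dot G (x *m P) (y *m P).
Proof. by rewrite /dot trmx_mul !mulmxA. Qed.

Lemma positive_on_row_free (M k : nat) (G : 'M[R]_M) (B : 'M[R]_(k, M)) :
  positive_on G B -> row_free B.
Proof.
move=> BP; apply/row_freeP/row_freeP; rewrite -kermx_eq0; apply/rowV0P => x.
move=> /sub_kermxP xB; apply/eqP/negPn/negP => /BP.
by rewrite xB dot0l ltxx.
Qed.

Lemma positive_on_le (M k : nat) (G : 'M[R]_M) (B : 'M[R]_(k, M)) :
  positive_on G B -> (k <= pos_index G)%N.
Proof.
move=> BP; have kM : (k < M.+1)%N.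
  rewrite ltnS; have := positive_on_row_free BP; rewrite /row_free => /eqP <-.
  exact: rank_leq_col.
have := @leq_bigmax_cond _ (fun k : 'I_M.+1 => `[< exists B : 'M[R]_(k, M),
  forall x : 'rV[R]_k, x != 0 -> 0 < dot G (x *m B) (x *m B) >])
  (fun k => nat_of_ord k) (Ordinal kM).
by apply; apply/asboolP; exists B.
Qed.

Lemma pos_index_attained (M : nat) (G : 'M[R]_M) :
  exists B : 'M[R]_(pos_index G, M), positive_on G B.
Proof.
pose P := [pred k : 'I_M.+1 | `[< exists B : 'M[R]_(k, M),
  forall x : 'rV[R]_k, x != 0 -> 0 < dot G (x *m B) (x *m B) >]].
have P0 : (0 < #|P|)%N.
  (* The zero subspace is vacuously positive, so the maximum is over a nonempty set. *)
  apply/card_gt0P; exists ord0; apply/asboolP; exists (0 : 'M[R]_(0, M)) => x.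
  by rewrite thinmx0 eqxx.
have [k /asboolP[B BP] E] := eq_bigmax_cond (fun k : 'I_M.+1 => nat_of_ord k) P0.
have E' : pos_index G = k by rewrite -E; apply: eq_bigl => i; rewrite inE.
by rewrite E'; exists B.
Qed.

(** Transport of subspaces gives one inequality for any matrix [Q]; it is applied to [P] and to its
    inverse. *)
Lemma pos_index_congr (M : nat) (G P : 'M[R]_M) : P \in unitmx ->
  pos_index (P *m G *m P^T) = pos_index G.
Proof.
move=> PU; have le (H Q : 'M[R]_M) : (pos_index (Q *m H *m Q^T) <= pos_index H)%N.
  have [B BP] := pos_index_attained (Q *m H *m Q^T).
  apply: (@positive_on_le _ _ _ (B *m Q)) => x /BP.
  by rewrite dot_congr mulmxA.
apply/eqP; rewrite eqn_leq le /=.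
have := le (P *m G *m P^T) (invmx P).
by rewrite !mulmxA mulVmx // mul1mx -mulmxA -trmx_mul mulVmx // trmx1 mulmx1.
Qed.

(** A positive and a negative subspace meet only in zero. *)
Lemma pos_index_neg_le (M : nat) (G : 'M[R]_M) :
  (pos_index G + pos_index (- G) <= M)%N.
Proof.
have [B BP] := pos_index_attained G; have [C CP] := pos_index_attained (- G).
suff : row_free (col_mx B C) by rewrite /row_free => /eqP <-; exact: rank_leq_col.
rewrite -kermx_eq0; apply/rowV0P => z /sub_kermxP.
rewrite -[z]hsubmxK mul_row_col => BC.
have {}BC : lsubmx z *m B = - (rsubmx z *m C) by apply/eqP; rewrite -addr_eq0 BC.
have zl : lsubmx z = 0.
  apply/eqP/negPn/negP => l0; have := BP _ l0.
  rewrite BC -scaleN1r dotZl dotZr !mulN1r opprK.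
  have [->|r0] := eqVneq (rsubmx z) 0; first by rewrite mul0mx dot0l ltxx.
  by have := CP _ r0; rewrite dotN oppr_gt0 => /lt_trans h /h; rewrite ltxx.
have zr : rsubmx z = 0.
  apply/eqP/negPn/negP => r0; have := CP _ r0.
  have /eqP := BC; rewrite zl mul0mx eq_sym oppr_eq0 => /eqP ->.
  by rewrite dot0l ltxx.
by rewrite zl zr row_mx0.
Qed.

(** The orthogonal complement [K] of a maximal positive subspace is negative definite: semidefinite
    by maximality, and definite because an isotropic vector in it would be orthogonal to the whole
    space. *)
Lemma pos_index_neg (M : nat) (G : 'M[R]_M) : nondeg_sym G ->
  (pos_index G + pos_index (- G))%N = M.
Proof.
move=> [GT GU]; apply/eqP; rewrite eqn_leq pos_index_neg_le /=.
have [B BP] := pos_index_attained G; set p := pos_index G in B BP *.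
have Bfree := positive_on_row_free BP.
pose K := row_base (kermx (G *m B^T)).
have orthK (x : 'rV[R]_(\rank (kermx (G *m B^T)))) : x *m K *m G *m B^T = 0.
  have : (x *m K <= kermx (G *m B^T))%MS.
    by apply: submx_trans (submxMl _ _) _; rewrite eq_row_base.
  by move=> /sub_kermxP; rewrite mulmxA.
have rk : \rank (kermx (G *m B^T)) = (M - p)%N.
  rewrite mxrank_ker eqmxMfull ?row_full_unit // mxrank_tr.
  by move: Bfree; rewrite /row_free => /eqP ->.
have perp (v : 'rV[R]_M) x : v *m G *m B^T = 0 -> dot G v (x *m B) = 0.
  by move=> vB; rewrite /dot trmx_mul mulmxA vB mul0mx mxE.
have nonpos v : v *m G *m B^T = 0 -> dot G v v <= 0.
  move=> vB; rewrite leNgt; apply/negP => v0.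
  (* Adjoining [v] would give a positive subspace of one dimension more. *)
  suff /positive_on_le : positive_on G (col_mx B v) by rewrite addn1 ltnn.
  move=> z; rewrite -[z]hsubmxK; set x := lsubmx z; set t := rsubmx z => z0.
  rewrite mul_row_col [t]mx11_scalar mul_scalar_mx dotDl !dotDr !dotZl !dotZr.
  rewrite [dot G (x *m B) v]dotC // (perp v) // !mulr0 addr0 add0r mulrA -expr2.
  have [x0|x0] := eqVneq x 0; last first.
    by rewrite ltr_wpDr ?BP // mulr_ge0 ?sqr_ge0 // ltW.
  rewrite x0 mul0mx dot0l add0r mulr_gt0 // lt_neqAle sqr_ge0 andbT eq_sym sqrf_eq0.
  apply: contra_neq z0 => t0; rewrite x0 [t]mx11_scalar t0.
  by rewrite raddf0 row_mx0.
pose Pm := B *m G *m B^T.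
have PU : Pm \in unitmx.
  rewrite -row_free_unit -kermx_eq0; apply/rowV0P => x /sub_kermxP xP.
  apply/eqP/negPn/negP => /BP; rewrite -dot_congr /dot.
  by rewrite -/Pm xP mul0mx mxE ltxx.
have isotropic v : v *m G *m B^T = 0 -> dot G v v = 0 -> v = 0.
  move=> vB v0; have cross w : w *m G *m B^T = 0 -> dot G v w = 0.
    move=> wB; set a := dot G v w; set b := dot G w w.
    have b0 : b <= 0 by exact: nonpos.
    have H t : 2 * t * a + t ^+ 2 * b <= 0.
      have : dot G (v + t *: w) (v + t *: w) <= 0.
        by apply: nonpos; rewrite !mulmxDl vB add0r -!scalemxAl wB scaler0.
      rewrite dotDl !dotDr !dotZl !dotZr v0 [dot G w v]dotC // -/a -/b.
      by apply: le_trans; rewrite le_eqVlt; apply/orP; left; apply/eqP; ring.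
    apply/eqP/negPn/negP => a0.
    have d0 : 0 < 1 - b by lra.
    (* A choice of [t] that also covers [b = 0]; as [b <= 0], the expression becomes
       [t ^ 2 * (2 - b)], positive unless [a] vanishes. *)
    have := H (a / (1 - b)).
    have -> : 2 * (a / (1 - b)) * a + (a / (1 - b)) ^+ 2 * b =
        (a / (1 - b)) ^+ 2 * (2 - b).
      by field; rewrite lt0r_neq0.
    rewrite leNgt mulr_gt0 //; last by lra.
    by rewrite lt_neqAle sqr_ge0 andbT eq_sym sqrf_eq0 mulf_neq0 // invr_eq0 lt0r_neq0.
  have all0 z : dot G v z = 0.
    (* Coordinates of the orthogonal projection of [z] to the span of [B]. *)
    pose x := z *m G *m B^T *m invmx Pm.
    have -> : z = x *m B + (z - x *m B) by rewrite addrC subrK.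
    rewrite dotDr (perp v) // add0r cross // !mulmxBl.
    have -> : x *m B *m G *m B^T = x *m Pm by rewrite /Pm !mulmxA.
    by rewrite /x mulmxKV // subrr.
  have vG : v *m G = 0.
    apply/rowP => k; have := all0 (delta_mx 0 k).
    by rewrite /dot trmx_delta -colE !mxE.
  by rewrite -[v](mulmxK GU) vG mul0mx.
have KP : positive_on (- G) K.
  move=> x x0; rewrite dotN oppr_gt0 lt_neqAle nonpos ?andbT //.
  apply: contra_neq x0 => /(isotropic _ (orthK x)) xK.
  have := row_base_free (kermx (G *m B^T)); rewrite -/K => /row_freeP[K' KK'].
  by rewrite -[x]mulmx1 -KK' mulmxA xK mul0mx.
by have := positive_on_le KP; rewrite rk leq_subLR.
Qed.

Lemma pos_index_block (m k : nat) (A : 'M[R]_m) (B : 'M[R]_k) :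
  (pos_index A + pos_index B <= pos_index (block_mx A 0 0 B))%N.
Proof.
have [P PP] := pos_index_attained A; have [Q QQ] := pos_index_attained B.
apply: (@positive_on_le _ _ _ (block_mx P 0 0 Q)) => z.
have E x y : dot (block_mx A 0 0 B) (row_mx x y) (row_mx x y) = dot A x x + dot B y y.
  rewrite /dot mul_row_block !mulmx0 addr0 add0r tr_row_mx mul_row_col.
  by rewrite [LHS]mxE.
rewrite -[z]hsubmxK mul_row_block !mulmx0 addr0 add0r E.
have nn (a p : nat) (S : 'M[R]_p) (F : 'M[R]_(a, p)) x :
    positive_on S F -> 0 <= dot S (x *m F) (x *m F).
  move=> SF; have [->|/SF/ltW//] := eqVneq x 0.
  by rewrite mul0mx dot0l.
have [x0|x0 _] := eqVneq (lsubmx z) 0; last first.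
  by rewrite ltr_wpDr ?PP ?nn.
have [y0|y0 _] := eqVneq (rsubmx z) 0; last first.
  by rewrite ltr_wpDl ?QQ ?nn.
by rewrite x0 y0 row_mx0 eqxx.
Qed.

(** The indices of [A], [B] and their opposites add up to [m + k], which those of the block matrix
    and its opposite cannot exceed; so the inequalities of [pos_index_block] are equalities. *)
Lemma signature_block (m k : nat) (A : 'M[R]_m) (B : 'M[R]_k) :
  nondeg_sym A -> nondeg_sym B ->
  signature (block_mx A 0 0 B) = signature A + signature B.
Proof.
move=> /pos_index_neg HA /pos_index_neg HB.
have h1 := pos_index_block A B; have h2 := pos_index_block (- A) (- B).
have := pos_index_neg_le (block_mx A 0 0 B).
move: h1 h2 HA HB; rewrite /signature opp_block_mx !oppr0.
move: (pos_index (block_mx A _ _ _)) (pos_index (block_mx (- A) _ _ _)) => p q.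
move: (pos_index A) (pos_index B) (pos_index (- A)) (pos_index (- B)).
by move=> a b a' b' h1 h2 <- <-; lia.
Qed.

Lemma signature_congr (M : nat) (G P : 'M[R]_M) : P \in unitmx ->
  signature (P *m G *m P^T) = signature G.
Proof.
move=> PU; rewrite /signature pos_index_congr //.
by rewrite -mulNmx -mulmxN pos_index_congr.
Qed.

Lemma signatureN (M : nat) (G : 'M[R]_M) : signature (- G) = - signature G.
Proof. by rewrite /signature opprK opprB. Qed.

End Signature.

(** * Signature of the ambient space *)

Section AmbientSignature.
Variables (R : realType) (N : nat).
Local Notation vec := 'rV[R]_N.

Lemma realizes_signature (eta : 'M[R]_N) Phi c (V : set vec)
    (G : 'M[R]_(N + N)) r nu u : nondeg_sym eta -> c != 0 ->
  realizes V G eta Phi c r nu -> V u ->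
  normal_gram G nu u = c^-1 *: eta /\
  signature G = signature eta + signature (normal_gram G nu u).
Proof.
move=> en c0 Hr Vu; have [etaT etaU] := en.
have [mu gram] := realizes_gram en c0 Hr Vu; split=> //.
have gm := (gram_mxP eta c (geo_frame r nu) G u).1 gram.
rewrite -(signature_congr G (frame_mx_unit en c0 gm)) gm mu signature_block //.
by split; [rewrite linearZ /= etaT|rewrite unitmxZ // unitfE invr_eq0].
Qed.

End AmbientSignature.

Theorem theorem7p1 (R : realType) (N : nat) (U : set 'rV[R]_N)
  (eta : 'M[R]_N) (Phi : 'rV[R]_N -> R) :
  open U -> nondeg_sym eta -> smooth U Phi ->
  (* consistency of the linear system is equivalent to associativity *)
  (forall c : R, c != 0 ->
     consistent U eta Phi c <-> associativity U eta Phi)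
  /\
  forall (mul : 'rV[R]_N -> 'rV[R]_N -> 'rV[R]_N -> 'rV[R]_N)
         (e E : 'rV[R]_N -> 'rV[R]_N),
  frobenius_manifold U eta mul e E ->
  given_by U eta mul Phi ->
  associativity U eta Phi ->
  (forall c : R, c != 0 ->
     (* the linear system is compatible *)
     consistent U eta Phi c
     /\
     (* locally it has a solution that is a realizing submanifold *)
     (forall u0, U u0 ->
        exists (V : set 'rV[R]_N) (G : 'M[R]_(N + N))
               (r n : 'rV[R]_N -> 'rV[R]_(N + N)),
          [/\ open V, V u0, V `<=` U, solves V eta Phi c r n
            & realizes V G eta Phi c r (fun l => pd l n)])
     /\
     (* a solution is a realizing submanifold as soon as its first-order data
        at one point have the prescribed scalar products *)
     (forall (V : set 'rV[R]_N) (G : 'M[R]_(N + N))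
             (r n : 'rV[R]_N -> 'rV[R]_(N + N)) (u0 : 'rV[R]_N),
        open V -> connected V -> V `<=` U -> V u0 -> nondeg_sym G ->
        solves V eta Phi c r n ->
        (forall i j, [/\ dot G (pd i r u0) (pd j r u0) = eta i j,
                         dot G (pd i r u0) (pd j n u0) = 0
                       & dot G (pd i n u0) (pd j n u0) = c^-1 * eta i j]) ->
        realizes V G eta Phi c r (fun l => pd l n))
     /\
     (forall (V : set 'rV[R]_N) (G : 'M[R]_(N + N))
             (r : 'rV[R]_N -> 'rV[R]_(N + N))
             (nu : 'I_N -> 'rV[R]_N -> 'rV[R]_(N + N)),
        V `<=` U -> realizes V G eta Phi c r nu ->
        [/\ (* a realizing submanifold satisfies the linear system, with
               normals nu l = d n / d u^l *)
            forall u0, V u0 ->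
              exists (W : set 'rV[R]_N) (n : 'rV[R]_N -> 'rV[R]_(N + N)),
                [/\ open W, W u0, W `<=` V, solves W eta Phi c r n
                  & forall u, W u -> forall l, nu l u = pd l n u],
            (* it is unique up to motions *)
            connected V -> V !=set0 ->
              forall (G' : 'M[R]_(N + N))
                     (r' : 'rV[R]_N -> 'rV[R]_(N + N))
                     (nu' : 'I_N -> 'rV[R]_N -> 'rV[R]_(N + N)),
              realizes V G' eta Phi c r' nu' ->
              exists (A : 'M[R]_(N + N)) (b : 'rV[R]_(N + N)),
                (forall x y, dot G' (x *m A) (y *m A) = dot G x y) /\
                forall u, V u ->
                  r' u = r u *m A + b /\ forall l, nu' l u = nu l u *m A,
            (* whatever c, it carries the given Frobenius multiplication *)
            forall u, V u -> forall X Y, induced_mul G r nu u X Y = mul u X Y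
          & (* signature of the ambient space *)
            forall u, V u ->
              signature G = signature eta + signature (normal_gram G nu u)]))
  /\
  (* c = 1 and c = -1 give ambient spaces of different signatures *)
  (signature eta != 0 ->
     forall (V1 V2 : set 'rV[R]_N) (G1 G2 : 'M[R]_(N + N))
            (r1 r2 : 'rV[R]_N -> 'rV[R]_(N + N))
            (nu1 nu2 : 'I_N -> 'rV[R]_N -> 'rV[R]_(N + N)),
     V1 `<=` U -> V1 !=set0 -> V2 `<=` U -> V2 !=set0 ->
     realizes V1 G1 eta Phi 1 r1 nu1 -> realizes V2 G2 eta Phi (-1) r2 nu2 ->
     signature G1 != signature G2).
Proof.
move=> oU en sPhi; split; first by move=> c c0; exact: consistent_associativity.
move=> mul e E [_ _ fm _ _] gb H; split; last first.
  move=> sig0 V1 V2 G1 G2 r1 r2 nu1 nu2 V1U [u1 V1u] V2U [u2 V2u] R1 R2.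
  have n10 : (-1 : R) != 0 by rewrite oppr_eq0 oner_eq0.
  have [mu1 ->] := realizes_signature en (oner_neq0 R) R1 V1u.
  have [mu2 ->] := realizes_signature en n10 R2 V2u.
  (* Twice the signature of [eta] for [c = 1], against zero for [c = -1]. *)
  rewrite mu1 mu2 invrN invr1 scale1r scaleN1r signatureN subrr.
  by rewrite -mulr2n mulrn_eq0.
move=> c c0; split; first exact/consistent_associativity.
split; first exact: (local_realization oU en sPhi c0 H).
split=> [V G r n u0 oV cV VU Vu0 GG sol init|V G r nu VU Hr].
  exact: (solution_realizes oU en sPhi c0 oV cV VU Vu0 GG sol init).
split=> [|cV V0 G' r' nu' Hr'|u Vu X Y|u Vu].
- exact: (realizes_local_potential oU en sPhi c0 H VU Hr).
- exact: (realizes_unique oU en sPhi c0 VU cV V0 Hr Hr').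
- exact: (realizes_induced_mul _ _ VU fm gb Hr Vu).
- exact: (realizes_signature en c0 Hr Vu).2.
Qed.
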